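(* There is a distorted embedding of $\mathbb{Z}\,\mathrm{wr}\,\mathbb{Z}$ into Thompson's group $F$; that is, there is an injective homomorphism $\mathbb{Z}\,\mathrm{wr}\,\mathbb{Z}\to F$ whose image is a distorted subgroup of $F$.
   Context: $\mathbb{Z}\,\mathrm{wr}\,\mathbb{Z}$ is the restricted wreath product. Thompson's group $F$ is the (finitely generated) group of piecewise-linear orientation-preserving homeomorphisms of $[0,1]$ with finitely many breakpoints, all at dyadic rationals, and with all slopes integer powers of $2$. For a group $G$ with finite generating set $T$ and a subgroup $H$ with finite generating set $S$, the distortion function is $\Delta_H^G(l)=\max\{|w|_S : w\in H, |w|_T\le l\}$. For non-decreasing functions $f,g$ on the nonnegative integers, $f\preceq g$ means there is an integer $C>0$ with $f(l)\le Cg(Cl)$ for all $l\ge 0$; $f\approx g$ means $f\preceq g$ and $g\preceq f$. $H$ is undistorted in $G$ if $\Delta_H^G(l)\approx l$, and distorted otherwise. *)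

(* Defs.v *)
From HB Require Import structures.
From mathcomp Require Import all_boot all_order all_algebra.
From mathcomp Require Import boolp classical_sets cardinality set_interval.
From mathcomp Require Import reals topology normedtype.

Set Implicit Arguments.
Unset Strict Implicit.
Unset Printing Implicit Defensive.

Import Order.TTheory GRing.Theory Num.Theory.
Import numFieldNormedType.Exports.

Local Open Scope classical_set_scope.

Definition is_minimum (A : set nat) (m : nat) : Prop :=
  A m /\ (forall n, A n -> m <= n).

Definition is_maximum (A : set nat) (m : nat) : Prop :=
  A m /\ (forall n, A n -> n <= m).

(* The value is 0 when there is no minimum (resp. maximum): see [word_lengthP]
   and [distortionP] for the fact that this does not occur below. *)
Definition nat_min (A : set nat) : nat := xget 0 [set m | is_minimum A m].
Definition nat_max (A : set nat) : nat := xget 0 [set m | is_maximum A m].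

Section Distortion.
Variable G : groupType.
Implicit Types (S T : seq G) (H : set G) (w : G).

Definition spelled S (n : nat) w : Prop :=
  exists s : seq G, [/\ size s = n,
    forall x, x \in s -> (x \in S) || ((x^-1)%g \in S) &
    w = (\prod_(x <- s) x)%g].

Definition generated S : set G := [set w | exists n, spelled S n w].

Definition generates S H : Prop := generated S = H.

Definition finitely_generated H : Prop := exists S, generates S H.

Definition word_length S w : nat := nat_min [set n | spelled S n w].

Definition distortion T S H (l : nat) : nat :=
  nat_max [set word_length S w | w in [set w | H w /\ word_length T w <= l]].

End Distortion.

Definition growth_le (f g : nat -> nat) : Prop :=
  exists2 C : nat, 0 < C & forall l, f l <= C * g (C * l).

Definition growth_equiv (f g : nat -> nat) : Prop :=
  growth_le f g /\ growth_le g f.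

(* The class of the distortion function does not depend on the finite
   generating sets, so quantifying over all of them is harmless; finite
   generation is required so that the quantification is not vacuous. *)
Definition distorted (G : groupType) (H : set G) : Prop :=
  [/\ finitely_generated [set: G], finitely_generated H &
    forall T S : seq G, generates T [set: G] -> generates S H ->
      ~ growth_equiv (distortion T S H) (fun l => l)].

Section DistortionFacts.
Variable G : groupType.
Implicit Types (S T : seq G) (H : set G) (w : G).

Lemma nat_minP (A : set nat) : A !=set0 -> is_minimum A (nat_min A).
Proof.
move=> [n An]; rewrite /nat_min.
have exA : exists n, `[< A n >] by exists n; apply/asboolP.
case: (ex_minnP exA) => m /asboolP Am minm.
case: xgetP => [? _ //|/(_ m)]; case; split=> // k Ak.
exact/minm/asboolP.
Qed.

Lemma nat_maxP (A : set nat) (b : nat) :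
  A !=set0 -> (forall n, A n -> n <= b) -> is_maximum A (nat_max A).
Proof.
move=> [n An] ub; rewrite /nat_max.
have exA : exists n, `[< A n >] by exists n; apply/asboolP.
have ubA k : `[< A k >] -> k <= b by move/asboolP/ub.
case: (ex_maxnP exA ubA) => m /asboolP Am maxm.
case: xgetP => [? _ //|/(_ m)]; case; split=> // k Ak.
exact/maxm/asboolP.
Qed.

Lemma word_lengthP S w :
  generated S w -> is_minimum [set n | spelled S n w] (word_length S w).
Proof. by move=> Sw; apply: nat_minP. Qed.

Lemma spelled0 S : spelled S 0 1%g.
Proof. by exists [::]; split=> //; rewrite big_nil. Qed.

Lemma finite_ball T (l : nat) :
  exists B : seq G, forall n w, n <= l -> spelled T n w -> w \in B.
Proof.
elim: l => [|l [B IH]].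
  exists [:: 1%g] => n w; rewrite leqn0 => /eqP-> [s [/size0nil-> _ ->]].
  by rewrite big_nil inE.
exists (1%g :: [seq (x * y)%g | x <- T ++ [seq (x^-1)%g | x <- T], y <- B]).
move=> n w nl [[|x s] [sn sT ->]]; first by rewrite big_nil inE eqxx.
rewrite big_cons inE; apply/orP; right; apply: allpairs_f.
  rewrite mem_cat; case/orP: (sT x (mem_head _ _)) => [->//|xT].
  by apply/orP; right; apply/mapP; exists (x^-1)%g; rewrite ?invgK.
apply: (IH (size s)); first by rewrite -ltnS (leq_trans _ nl) // -sn.
by exists s; split=> // y ys; apply: sT; rewrite inE ys orbT.
Qed.

Lemma distortionP T S H (l : nat) :
  generates T [set: G] -> generates S H ->
  is_maximum
    [set word_length S w | w in [set w | H w /\ word_length T w <= l]]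
    (distortion T S H l).
Proof.
move=> genT genS; have [B HB] := finite_ball T l.
have ub : forall n,
  [set word_length S w | w in [set w | H w /\ word_length T w <= l]] n ->
  n <= \max_(w <- B) word_length S w.
  move=> _ [w [_ wl] <-]; apply: leq_bigmax_seq => //.
  apply: (HB _ _ wl).
  by have [] := @word_lengthP T w (eq_ind_r (fun X : set G => X w) I genT).
apply: nat_maxP ub.
exists (word_length S 1%g), 1%g => //; split.
  by rewrite -genS; exists 0; exact: spelled0.
have T1 : generated T 1%g by exists 0; exact: spelled0.
by have [_ /(_ 0 (spelled0 T))] := word_lengthP T1; rewrite leqn0 => /eqP->.
Qed.

End DistortionFacts.

(* [A^B x| B], where [b : B] acts on [B -> A] by [(b . g) x = g (b^-1 x)]; the
   restricted wreath product [wreath] below is the subgroup of finitely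
   supported functions. *)
Definition unrestricted_wreath (A B : groupType) : Type := ((B -> A) * B)%type.

Section UnrestrictedWreath.
Variables A B : groupType.
Local Notation W := (unrestricted_wreath A B).
Local Open Scope group_scope.

HB.instance Definition _ := Choice.on W.

Definition wreath_one : W := (fun=> 1, 1).
Definition wreath_mul (u v : W) : W :=
  (fun x => u.1 x * v.1 (u.2^-1 * x), u.2 * v.2).
Definition wreath_inv (u : W) : W := (fun x => (u.1 (u.2 * x))^-1, u.2^-1).

Fact wreath_mulA : associative wreath_mul.
Proof.
move=> u v w; congr pair; last by rewrite /= mulgA.
by apply/funext => x /=; rewrite invgM !mulgA.
Qed.

Fact wreath_mul1 : left_id wreath_one wreath_mul.
Proof.
move=> [f b]; congr pair; last by rewrite /= mul1g.
by apply/funext => x /=; rewrite invg1 !mul1g.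
Qed.

Fact wreath_mulr1 : right_id wreath_one wreath_mul.
Proof.
move=> [f b]; congr pair; last by rewrite /= mulg1.
by apply/funext => x /=; rewrite mulg1.
Qed.

Fact wreath_mulV : left_inverse wreath_one wreath_inv wreath_mul.
Proof.
move=> [f b]; congr pair; last by rewrite /= mulVg.
by apply/funext => x /=; rewrite invgK mulVg.
Qed.

Fact wreath_mulrV : right_inverse wreath_one wreath_inv wreath_mul.
Proof.
move=> [f b]; congr pair; last by rewrite /= mulgV.
by apply/funext => x /=; rewrite mulgA mulgV mul1g mulgV.
Qed.

HB.instance Definition _ := isGroup.Build W
  wreath_mulA wreath_mul1 wreath_mulr1 wreath_mulV wreath_mulrV.

Definition restricted : {pred W} :=
  fun u => `[< finite_set [set x | u.1 x <> 1] >].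

Fact restricted_closed : group_closed restricted.
Proof.
split=> [|u v /asboolP fu /asboolP fv]; apply/asboolP.
  by rewrite (_ : [set x | _] = set0) //; apply/seteqP; split=> x //=; apply.
apply: (@sub_finite_set _ _
  ([set x | u.1 x <> 1] `|` (fun x => u.2 * (v.2^-1 * x)) @`
    [set x | v.1 x <> 1])).
  move=> x /= neq1; have [ux|] := pselect (u.1 x = 1); last by left.
  right; exists (v.2 * (u.2^-1 * x)); last by rewrite mulKg mulVKg.
  by move=> vx; apply: neq1; rewrite ux vx invg1 mulg1.
by rewrite finite_setU; split=> //; exact: finite_image.
Qed.

End UnrestrictedWreath.

Record wreath (A B : groupType) := Wreath {
  wreath_val : unrestricted_wreath A B;
  _ : wreath_val \in @restricted A B }.

HB.instance Definition _ (A B : groupType) := [isSub for @wreath_val A B].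
HB.instance Definition _ (A B : groupType) := [Choice of wreath A B by <:].
HB.instance Definition _ (A B : groupType) :=
  SubChoice_isSubGroup.Build _ _ (wreath A B) (@restricted_closed A B).

Record homeo (X : topologicalType) := Homeo {
  homeo_fun :> X -> X;
  homeo_inv : X -> X;
  homeo_funK : cancel homeo_fun homeo_inv;
  homeo_invK : cancel homeo_inv homeo_fun;
  homeo_fun_cont : continuous homeo_fun;
  homeo_inv_cont : continuous homeo_inv }.

HB.instance Definition _ (X : topologicalType) := gen_eqMixin (homeo X).
HB.instance Definition _ (X : topologicalType) := gen_choiceMixin (homeo X).

Section HomeoGroup.
Variable X : topologicalType.
Implicit Types f g h : homeo X.

Lemma homeoP f g : f =1 g -> f = g.
Proof.
case: f g => [f f' fK f'K cf cf'] [g g' gK g'K cg cg'] /= fg.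
have efg : f = g by apply/funext.
have efg' : f' = g' by apply/funext => x; rewrite -{1}(g'K x) -fg fK.
by subst g g'; congr Homeo; exact: Prop_irrelevance.
Qed.

Definition homeo_one : homeo X :=
  @Homeo X idfun idfun (fun=> erefl) (fun=> erefl)
    (fun _ => cvg_id) (fun _ => cvg_id).

Definition homeo_mul f g : homeo X :=
  @Homeo X (f \o g) (homeo_inv g \o homeo_inv f)
    (can_comp (@homeo_funK _ f) (@homeo_funK _ g))
    (can_comp (@homeo_invK _ g) (@homeo_invK _ f))
    (fun x => continuous_comp (@homeo_fun_cont _ g x) (@homeo_fun_cont _ f _))
    (fun x => continuous_comp (@homeo_inv_cont _ f x) (@homeo_inv_cont _ g _)).

Definition homeo_invg f : homeo X :=
  @Homeo X (homeo_inv f) f (@homeo_invK _ f) (@homeo_funK _ f)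
    (@homeo_inv_cont _ f) (@homeo_fun_cont _ f).

Fact homeo_mulA : associative homeo_mul.
Proof. by move=> f g h; apply: homeoP. Qed.

Fact homeo_mul1 : left_id homeo_one homeo_mul.
Proof. by move=> f; apply: homeoP. Qed.

Fact homeo_mulr1 : right_id homeo_one homeo_mul.
Proof. by move=> f; apply: homeoP. Qed.

Fact homeo_mulV : left_inverse homeo_one homeo_invg homeo_mul.
Proof. by move=> f; apply: homeoP => x /=; rewrite homeo_funK. Qed.

Fact homeo_mulrV : right_inverse homeo_one homeo_invg homeo_mul.
Proof. by move=> f; apply: homeoP => x /=; rewrite homeo_invK. Qed.

HB.instance Definition _ := isGroup.Build (homeo X)
  homeo_mulA homeo_mul1 homeo_mulr1 homeo_mulV homeo_mulrV.

End HomeoGroup.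

Local Open Scope ring_scope.

Section Thompson.
Variable R : realType.

Definition unit_interval : set R := [set` `[0, 1]].
(* [set_type] carries the subspace topology. *)
Definition I01 : Type := set_type unit_interval.
HB.instance Definition _ := Topological.on I01.
Definition I01_val (x : I01) : R := val x.

Definition dyadic (x : R) : Prop :=
  exists (m : int) (n : nat), x = m%:~R / 2 ^+ n.

Definition orientation_preserving (f : I01 -> I01) : Prop :=
  forall x y, I01_val x < I01_val y -> I01_val (f x) < I01_val (f y).

(* [s] contains all the breakpoints: [f] is affine, of slope an integer power
   of 2, on each interval [[a, b]] whose interior contains no element of [s]. *)
Definition dyadic_pl (f : I01 -> I01) : Prop :=
  exists2 s : seq R, (forall c, c \in s -> dyadic c) &
    forall a b : I01, I01_val a < I01_val b ->
      (forall c, c \in s -> ~~ (I01_val a < c < I01_val b)) ->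
      exists k : int, forall x : I01,
        I01_val a <= I01_val x <= I01_val b ->
        I01_val (f x) = I01_val (f a) + 2 ^ k * (I01_val x - I01_val a).

Definition in_thompson : {pred homeo I01} :=
  fun f => `[< orientation_preserving f /\ dyadic_pl f >].

Lemma I01_inj (x y : I01) : I01_val x = I01_val y -> x = y.
Proof. exact: val_inj. Qed.

Lemma I01_bounds (x : I01) : 0 <= I01_val x <= 1.
Proof.
by case: x => x xin; have := set_mem xin; rewrite /unit_interval /= in_itv.
Qed.

Definition I01_sub (x : R) (x01 : 0 <= x <= 1) : I01 :=
  exist _ x (mem_set (x01 : unit_interval x)).

Lemma dyadicD x y : dyadic x -> dyadic y -> dyadic (x + y).
Proof.
move=> [m [n ->]] [p [q ->]].
exists (m * 2 ^+ q + p * 2 ^+ n), (n + q)%N.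
have p0 k : (2 : R) ^+ k != 0 by rewrite expf_neq0// pnatr_eq0.
rewrite exprD rmorphD !rmorphM !rmorphXn /= mulrDl -mulf_div divff// mulr1.
by rewrite [2 ^+ n * 2 ^+ q]mulrC -mulf_div divff// mulr1.
Qed.

Lemma dyadicN x : dyadic x -> dyadic (- x).
Proof. by move=> [m [n ->]]; exists (- m), n; rewrite rmorphN mulNr. Qed.

Lemma dyadic_pow2 (k : int) x : dyadic x -> dyadic (2 ^ k * x).
Proof.
move=> [m [n ->]]; case: k => k.
  by exists (2 ^+ k * m), n; rewrite rmorphM rmorphXn /= mulrA.
by exists m, (k.+1 + n)%N; rewrite NegzE -exprnN exprD invfM mulrCA.
Qed.

Lemma dyadic0 : dyadic 0.
Proof. by exists 0, 0; rewrite mul0r. Qed.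

Section InThompson.
Variable f : homeo I01.
Hypotheses (incr : orientation_preserving f) (pl : dyadic_pl f).

Lemma orientation_preserving_inv : orientation_preserving (homeo_inv f).
Proof.
move=> x y xy; rewrite ltNge; apply/negP; rewrite le_eqVlt => /orP[/eqP|].
  move/I01_inj/(can_inj (@homeo_invK _ f)) => yx.
  by rewrite yx ltxx in xy.
by move/incr; rewrite !homeo_invK => /(lt_trans xy); rewrite ltxx.
Qed.

Lemma homeo_fix0 (z : I01) : I01_val z = 0 -> I01_val (f z) = 0.
Proof.
move=> z0; have /andP[fz0 _] := I01_bounds (f z).
have /andP[y0 _] := I01_bounds (homeo_inv f z).
move: y0; rewrite le_eqVlt => /orP[/eqP y0|y0].
  by rewrite (_ : f z = z) // -{2}[z](homeo_invK f); congr (f _);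
     apply: I01_inj; rewrite z0.
have : I01_val (f z) < I01_val (f (homeo_inv f z)) by apply: incr; rewrite z0.
by rewrite homeo_invK z0 ltNge fz0.
Qed.

Lemma seq_max (c0 : R) (t : seq R) : c0 \in t ->
  exists2 b, b \in t & forall c, c \in t -> c <= b.
Proof.
elim: t c0 => // c u IH c0 _; have [->|] := eqVneq u [::].
  by exists c; rewrite ?mem_head // => d; rewrite inE => /eqP->.
case: u IH => // e u IH _; have [b bu bm] := IH _ (mem_head _ _).
have [cb|bc] := leP c b.
  by exists b; rewrite ?[_ \in c :: _]inE ?bu ?orbT// => d /predU1P[->//|/bm].
exists c; rewrite ?mem_head// => d /predU1P[->//|/bm db].
by rewrite (le_trans db) ?ltW.
Qed.

Lemma homeo_dyadic x : dyadic (I01_val x) -> dyadic (I01_val (f x)).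
Proof.
case: pl => s sdy saff.
have [n] := ubnP (count (fun c => c < I01_val x) s).
elim: n x => // n IH x ltn xdy.
have /andP[x0 x1] := I01_bounds x.
have b01 : 0 <= (0 : R) <= 1 by rewrite lexx ler01.
pose z : I01 := I01_sub b01.
have fz0 : I01_val (f z) = 0 by apply: homeo_fix0.
move: x0; rewrite le_eqVlt => /orP[/eqP xz|x0].
  by rewrite (_ : x = z) ?fz0; [exact: dyadic0|exact: I01_inj].
pose t := [seq c <- s | 0 < c < I01_val x].
suff [b [bx bdy fbdy bgap]] : exists b : I01, [/\ I01_val b < I01_val x,
    dyadic (I01_val b), dyadic (I01_val (f b)) &
    forall c, c \in s -> ~~ (I01_val b < c < I01_val x)].
  have [k ->] := saff b x bx bgap; last by rewrite lexx ltW.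
  by apply: dyadicD => //; apply: dyadic_pow2; apply/dyadicD/dyadicN.
have [[c0 /seq_max[b]]|tN] := pselect (exists c, c \in t); last first.
  exists z; split=> //; rewrite ?fz0; try exact: dyadic0.
  move=> c cs; apply/negP => cx; apply: tN; exists c.
  by rewrite mem_filter cx.
rewrite mem_filter => /andP[/andP[b0 bx] bs] bmax.
have bb : 0 <= b <= 1 by rewrite (ltW b0) (le_trans (ltW bx)).
exists (I01_sub bb); split=> //; first exact: sdy.
  apply: IH; last exact: sdy.
  rewrite -ltnS (leq_trans _ ltn) // ltnS !(permP (perm_to_rem bs)) /= ltxx bx.
  by rewrite add0n add1n ltnS; apply: sub_count => c /= /lt_trans; apply.
move=> c cs; apply/negP => /andP[/= bc cx].
have /bmax : c \in t by rewrite mem_filter cs cx (lt_trans b0).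
by rewrite leNgt bc.
Qed.

End InThompson.

Definition ext (f : I01 -> I01) (c : R) : R :=
  if @idP (0 <= c <= 1) is ReflectT c01 then I01_val (f (I01_sub c01)) else 0.

Lemma extE (f : I01 -> I01) (x : I01) : ext f (I01_val x) = I01_val (f x).
Proof.
rewrite /ext; case: {-}_ / idP => [c01|]; last by rewrite I01_bounds.
by congr (I01_val (f _)); apply: I01_inj.
Qed.

Lemma homeo_invgE (f : homeo I01) : (f^-1)%g = homeo_invg f.
Proof. by []. Qed.

Lemma homeo_mulgE (f g : homeo I01) : (f * g)%g = homeo_mul f g.
Proof. by []. Qed.

Lemma in_thompsonV : invg_closed in_thompson.
Proof.
move=> f /asboolP[incr pl]; apply/asboolP.
have incr' := orientation_preserving_inv incr; split=> //.
have [s sdy saff] := pl.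
exists [seq ext f c | c <- s] => [_ /mapP[c cs ->]|a b ab abs].
  rewrite /ext; case: {-}_ / idP => [c01|_]; last exact: dyadic0.
  by apply: homeo_dyadic => //; exact: sdy.
have [|k kP] := saff (homeo_inv f a) (homeo_inv f b) (incr' _ _ ab).
  move=> c cs; apply/negP => /andP[ac cb].
  have c01 : 0 <= c <= 1.
    have /andP[a0 _] := I01_bounds (homeo_inv f a).
    have /andP[_ b1] := I01_bounds (homeo_inv f b).
    by rewrite (le_trans a0 (ltW ac)) (le_trans (ltW cb) b1).
  have /negP := abs _ (map_f (ext f) cs); apply.
  rewrite -[c]/(I01_val (I01_sub c01)) extE.
  rewrite -[a](homeo_invK f) -[b](homeo_invK f).
  by rewrite (incr _ (I01_sub c01) ac) (incr (I01_sub c01) _ cb).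
exists (- k) => x /andP[ax xb].
have mono (y y' : I01) : I01_val y <= I01_val y' ->
    I01_val (homeo_inv f y) <= I01_val (homeo_inv f y').
  by rewrite le_eqVlt => /orP[/eqP/I01_inj->//|/incr'/ltW].
have := kP (homeo_inv f x); rewrite !mono// !homeo_invK => /(_ isT) ->.
have k0 : (2 : R) ^ k != 0 by rewrite expfz_neq0// pnatr_eq0.
rewrite [in RHS]addrAC subrr add0r -invr_expz mulKf//.
by rewrite [in RHS]addrC subrK.
Qed.

Lemma in_thompsonM : mulg_closed in_thompson.
Proof.
move=> f g fF gF; move: (in_thompsonV gF) => /asboolP[_ pl'].
move: fF gF => /asboolP[fincr [s sdy saff]] /asboolP[gincr [t tdy taff]].
have gincr' := orientation_preserving_inv gincr.
apply/asboolP; split; first by move=> x y /gincr/fincr.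
exists (t ++ [seq ext (homeo_inv g) c | c <- s]) => [c|a b ab abs].
  rewrite mem_cat => /orP[/tdy//|/mapP[{}c cs ->]].
  rewrite /ext; case: {-}_ / idP => [c01|_]; last exact: dyadic0.
  apply: (@homeo_dyadic (g^-1)%g) => //.
  exact: sdy.
have [c ct|k kP] := taff a b ab; first by apply: abs; rewrite mem_cat ct.
have [|l lP] := saff (g a) (g b) (gincr _ _ ab).
  move=> c cs; apply/negP => /andP[ac cb].
  have c01 : 0 <= c <= 1.
    have /andP[a0 _] := I01_bounds (g a).
    have /andP[_ b1] := I01_bounds (g b).
    by rewrite (le_trans a0 (ltW ac)) (le_trans (ltW cb) b1).
  suff /abs/negP : ext (homeo_inv g) c \in
      t ++ [seq ext (homeo_inv g) c | c <- s].
    apply.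
    rewrite -[c]/(I01_val (I01_sub c01)) extE.
    rewrite -[a](homeo_funK g) -[b](homeo_funK g).
    by rewrite (gincr' _ (I01_sub c01) ac) (gincr' (I01_sub c01) _ cb).
  by rewrite mem_cat map_f ?orbT.
have mono (y y' : I01) : I01_val y <= I01_val y' ->
    I01_val (g y) <= I01_val (g y').
  by rewrite le_eqVlt => /orP[/eqP/I01_inj->//|/gincr/ltW].
exists (l + k) => x axb; have /andP[ax xb] := axb.
by rewrite /= lP ?mono// kP// addrAC subrr add0r mulrA expfzDr// pnatr_eq0.
Qed.

Lemma in_thompson_closed : group_closed in_thompson.
Proof.
split=> [|f g fF gF]; last by apply: in_thompsonM => //; apply: in_thompsonV.
apply/asboolP; split=> //; exists [::] => // a b ab _.
by exists 0 => x _; rewrite expr0z mul1r addrC subrK.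
Qed.

End Thompson.

(* The group law is composition, [(f * g) x = f (g x)]. *)
Record thompson (R : realType) := Thompson {
  thompson_val : homeo (I01 R);
  _ : thompson_val \in @in_thompson R }.

HB.instance Definition _ (R : realType) := [isSub for @thompson_val R].
HB.instance Definition _ (R : realType) := [Choice of thompson R by <:].
HB.instance Definition _ (R : realType) :=
  SubChoice_isSubGroup.Build _ _ (thompson R) (@in_thompson_closed R).

(* Main.v *)
(* Let B be the standard generator x_0 of F and A an element supported in the
   fundamental domain [1/2, 3/4] of B, so that the conjugates A_i = B^i A B^-i
   have disjoint supports.  Sending the lamp generator to C = A_0 A_1^-1 and the
   shift to B embeds Z wr Z into F: the topmost C_i of a product of powers is
   the only one moving the support of A_(i+1).  The commutator [A^l, B^l] has
   length O(l) in F; it equals \prod_(j < l) B^j C^l B^-j, the image of an element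
   whose total lamp content is l^2.  Total lamp content is a homomorphism
   to Z, hence at most linear in the word length of the image, so the distortion
   is at least quadratic.
   F is generated by x_0 and x_1: every element maps some dyadic subdivision of
   [0, 1] onto another one affinely on each interval, and any subdivision
   obtained by successive halvings is carried onto the subdivision
   0, 1/2, 3/4, 7/8, ... by the group generated by x_0 and x_1, by induction on
   the number of halvings. *)
Require Import Defs.
From HB Require Import structures.
From mathcomp Require Import all_boot all_order all_algebra.
From mathcomp Require Import boolp classical_sets cardinality reals.
From mathcomp Require Import topology normedtype.
From mathcomp Require Import zify ring lra.

Set Implicit Arguments.
Unset Strict Implicit.
Unset Printing Implicit Defensive.

Import Order.TTheory GRing.Theory Num.Theory.
Import numFieldNormedType.Exports.

Local Open Scope classical_set_scope.

(** * The wreath product and a quadratic lower bound *)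

Section IntegerPowers.
Variable G : groupType.
Implicit Types (x y z : G) (m n : int).
Local Open Scope group_scope.

Definition zpow x n : G := if n is Posz k then x ^+ k else x ^- (`|n|%N).

Lemma zpowN x n : zpow x (- n) = (zpow x n)^-1.
Proof. by case: n => [[|k]|k] //=; rewrite ?invg1 // invgK. Qed.

Lemma zpowSr x n : zpow x (n + 1) = zpow x n * x.
Proof.
case: n => [k|k]; first by rewrite -PoszD addn1 /= expgSr.
have -> : (Negz k + 1 = - k%:Z)%R by rewrite NegzE; lia.
by rewrite zpowN /= expgS invgM mulgVK.
Qed.

Lemma zpowD x m n : zpow x (m + n) = zpow x m * zpow x n.
Proof.
have pos p (k : nat) : zpow x (p + k%:Z) = zpow x p * zpow x k.
  elim: k => [|k IH]; first by rewrite addr0 mulg1.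
  by rewrite -addn1 PoszD addrA !zpowSr IH mulgA.
case: n => k; first exact: pos.
apply: (mulIg (zpow x k.+1)); rewrite -pos -mulgA NegzE zpowN mulVg mulg1.
by rewrite subrK.
Qed.

Lemma commute_conj x y z : commute x y -> commute (x ^ z) (y ^ z).
Proof. by rewrite /commute -!conjMg => ->. Qed.

Lemma commute_zpow x y n : commute x y -> commute x (zpow y n).
Proof. by case: n => k xy /=; [|apply: commuteV]; apply: commuteX. Qed.

Lemma zpowJ x y n : zpow x n ^ y = zpow (x ^ y) n.
Proof. by case: n => k /=; rewrite ?conjVg conjXg. Qed.

Lemma commute_big_perm (I : eqType) (s t : seq I) (F : I -> G) :
  (forall i j, commute (F i) (F j)) -> perm_eq s t ->
  \prod_(i <- s) F i = \prod_(i <- t) F i.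
Proof.
move=> cF; elim: s t => [|i s IH] t.
  by rewrite perm_sym => /perm_nilP->.
move=> st; have it : i \in t by rewrite -(perm_mem st) mem_head.
case/splitPr: it st => t1 t2.
(* Rotate [t1 ++ i :: t2] to bring [i] to the front, cancel it, and rotate back to [t1 ++ t2]. *)
rewrite perm_sym perm_catC /= perm_cons perm_sym perm_sym perm_catC perm_sym => st.
rewrite big_cons (IH _ st) !big_cat /= big_cons !mulgA; congr (_ * _).
by apply: commute_prod => j _; exact: cF.
Qed.

End IntegerPowers.

(** * Words in a finite set and the subgroup it generates *)

Section Spelled.
Variable G : groupType.
Implicit Types (S : seq G) (x y : G).
Local Open Scope group_scope.

Lemma spelledM S m n x y :
  spelled S m x -> spelled S n y -> spelled S (m + n) (x * y).
Proof.
move=> [s [<- sS ->]] [t [<- tS ->]]; exists (s ++ t); rewrite size_cat big_cat.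
by split=> // z; rewrite mem_cat => /orP[/sS|/tS].
Qed.

Lemma spelledV S m x : spelled S m x -> spelled S m x^-1.
Proof.
move=> [s [<- sS ->]]; exists (rev [seq x^-1 | x <- s]); rewrite size_rev size_map.
split=> // [y|]; last by rewrite -map_rev big_map prodgV revK.
rewrite mem_rev => /mapP[z /sS zS ->]; by rewrite invgK orbC.
Qed.

Lemma spelledX S m k x : spelled S m x -> spelled S (k * m) (x ^+ k).
Proof.
move=> Sx; elim: k => [|k IH]; first exact: spelled0.
by rewrite expgS mulSn; apply: spelledM.
Qed.

Lemma spelled_mem S x : x \in S -> spelled S 1 x.
Proof.
move=> xS; exists [:: x]; rewrite big_seq1; split=> // y.
by rewrite inE => /eqP->; rewrite xS.
Qed.

Lemma generatedM S x y : generated S x -> generated S y -> generated S (x * y).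
Proof. by move=> [m Sx] [n Sy]; exists (m + n)%N; apply: spelledM. Qed.

Lemma generatedV S x : generated S x -> generated S x^-1.
Proof. by move=> [m Sx]; exists m; apply: spelledV. Qed.

Lemma generated1 S : generated S 1.
Proof. by exists 0%N; apply: spelled0. Qed.

Lemma generated_mem S x : x \in S -> generated S x.
Proof. by exists 1%N; apply: spelled_mem. Qed.

Lemma generated_zpow S x n : generated S x -> generated S (zpow x n).
Proof.
move=> [m Sx]; have SX k : generated S (x ^+ k) by exists (k * m)%N; exact: spelledX.
by case: n => k //=; exact: generatedV.
Qed.

Lemma word_length_le S m x : spelled S m x -> word_length S x <= m.
Proof.
by move=> Sx; have [|_] := @word_lengthP _ S x; [exists m|apply].
Qed.

End Spelled.

Local Notation Zm := (Algebra.to_multiplicative int).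
Local Notation ZwrZ := (wreath Zm Zm).

(** * Homomorphisms out of Z wr Z *)

Section WreathHom.
Local Open Scope group_scope.
Implicit Types (u v : ZwrZ) (i n : int).

Definition lamp u : int -> int := (wreath_val u).1.
Definition cursor u : int := (wreath_val u).2.

Lemma lampM u v i : lamp (u * v) i = (lamp u i + lamp v (i - cursor u))%R.
Proof. by rewrite [(i - _)%R]addrC. Qed.

Lemma cursorM u v : cursor (u * v) = (cursor u + cursor v)%R.
Proof. by []. Qed.

Lemma ZwrZ_ext u v : lamp u =1 lamp v -> cursor u = cursor v -> u = v.
Proof.
case: u v => [[f m] fP] [[g n] gP] /= fg mn; apply: val_inj => /=.
by congr pair; [apply/funext => i; apply: fg|].
Qed.

Lemma lamp_finite u :
  exists2 s : seq int, uniq s & forall i, lamp u i <> 0%R -> i \in s.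
Proof.
case: u => [[f n] fP]; have /asboolP/finite_seqP[s sE] := fP.
exists (undup s); first exact: undup_uniq.
move=> i fi; rewrite mem_undup.
by have : [set` s] i by rewrite -sE.
Qed.

(** A chosen list, only known to be duplicate-free and to contain the support; [lamps_indep] makes
    the choice harmless. *)
Definition lamp_supp u : seq int := s2val (cid2 (lamp_finite u)).

Lemma lamp_supp_uniq u : uniq (lamp_supp u).
Proof. exact: s2valP (cid2 (lamp_finite u)). Qed.

Lemma lamp_suppP u i : lamp u i <> 0%R -> i \in lamp_supp u.
Proof. exact: s2valP' (cid2 (lamp_finite u)) i. Qed.

Variables (G : groupType) (a b : G).

(** Since [x ^ y] is y^-1 x y, this is b^i a b^-i, the lamp at position i. *)
Definition lamp_at i : G := a ^ zpow b (- i).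

Definition lamps (s : seq int) (f : int -> int) : G :=
  \prod_(i <- s) zpow (lamp_at i) (f i).

(** Follows the factorisation (f, n) = (f, 0)(0, n): first the lamps, then the shift. *)
Definition wreath_hom u : G := lamps (lamp_supp u) (lamp u) * zpow b (cursor u).

Lemma lamp_atJ i n : lamp_at i ^ zpow b (- n) = lamp_at (i + n).
Proof. by rewrite -conjgM -zpowD -opprD. Qed.

Lemma lampsJ s f n :
  lamps s f ^ zpow b (- n) = lamps [seq (i + n)%R | i <- s] (fun i => f (i - n)%R).
Proof.
rewrite /lamps conjg_prod big_map; apply: eq_bigr => i _.
by rewrite zpowJ lamp_atJ addrK.
Qed.

Hypothesis lamp_comm : forall n, commute a (lamp_at n).

Lemma lamp_at_comm i j : commute (lamp_at i) (lamp_at j).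
Proof.
have := commute_conj (zpow b (- i)) (lamp_comm (j - i)).
by rewrite lamp_atJ subrK.
Qed.

Lemma zpow_lamp_comm i j m n : commute (zpow (lamp_at i) m) (zpow (lamp_at j) n).
Proof.
by apply/commute_zpow/commute_sym/commute_zpow/commute_sym/lamp_at_comm.
Qed.

Lemma lampsD s f g :
  lamps s (fun i => f i + g i)%R = lamps s f * lamps s g.
Proof.
rewrite /lamps -prodgM_commute => [|i j _ _]; last exact: zpow_lamp_comm.
by apply: eq_bigr => i _; rewrite zpowD.
Qed.

(** Indices with zero lamp contribute trivial factors; once these are removed, both lists enumerate
    the support, and the factors commute. *)
Lemma lamps_indep s t f : uniq s -> uniq t ->
  (forall i, f i <> 0%R -> i \in s) -> (forall i, f i <> 0%R -> i \in t) ->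
  lamps s f = lamps t f.
Proof.
move=> us ut fs ft.
have filt r : lamps r f = lamps [seq i <- r | f i != 0%R] f.
  rewrite /lamps big_filter; elim: r => [|i r IH]; first by rewrite !big_nil.
  by rewrite !big_cons IH; case: eqP => //= ->; rewrite mul1g.
rewrite filt [RHS]filt; apply: commute_big_perm => [i j|].
  exact: zpow_lamp_comm.
apply: uniq_perm; rewrite ?filter_uniq // => i; rewrite !mem_filter.
by case: eqP => //= fi; rewrite fs ?ft.
Qed.

Lemma wreath_homE s u : uniq s -> (forall i, lamp u i <> 0%R -> i \in s) ->
  wreath_hom u = lamps s (lamp u) * zpow b (cursor u).
Proof.
move=> us su; congr (_ * _).
by apply: lamps_indep => //; [exact: lamp_supp_uniq|exact: lamp_suppP].
Qed.

(** Moving b^(cursor u) rightwards past the lamps of [v] conjugates them, which shifts their indices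
    by [cursor u] exactly as the product of the wreath product does. *)
Lemma wreath_homM : {morph wreath_hom : u v / u * v}.
Proof.
move=> u v.
(* One list large enough for the lamps of [u], of the shifted [v] and of the product, so that
   [lampsD] applies. *)
pose s := undup (lamp_supp (u * v) ++ lamp_supp u ++
  [seq (i + cursor u)%R | i <- lamp_supp v]).
have us : uniq s by exact: undup_uniq.
rewrite (@wreath_homE s) // => [|i /lamp_suppP iuv]; last first.
  by rewrite mem_undup mem_cat iuv.
have -> : lamp (u * v) = (fun i => lamp u i + lamp v (i - cursor u))%R.
  by apply/funext => i; rewrite lampM.
have vs i : lamp v (i - cursor u) <> 0%R ->
    i \in [seq (i + cursor u)%R | i <- lamp_supp v].
  by move/lamp_suppP/(map_f (fun i => i + cursor u)%R); rewrite subrK.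
rewrite lampsD (@lamps_indep s (lamp_supp u)) //; first last.
- exact: lamp_suppP.
- by move=> i /lamp_suppP iu; rewrite mem_undup !mem_cat iu !orbT.
- exact: lamp_supp_uniq.
rewrite (@lamps_indep s [seq (i + cursor u)%R | i <- lamp_supp v]) //; first last.
- by move=> i /vs iv; rewrite mem_undup !mem_cat iv !orbT.
- by rewrite map_inj_uniq ?lamp_supp_uniq //; exact: addIr.
rewrite -lampsJ cursorM zpowD zpowN conjgE invgK /wreath_hom.
by rewrite !mulgA mulgVK.
Qed.

Lemma wreath_hom1 : wreath_hom 1 = 1.
Proof. by apply: (mulgI (wreath_hom 1)); rewrite -wreath_homM !mulg1. Qed.

Lemma wreath_homV u : wreath_hom u^-1 = (wreath_hom u)^-1.
Proof.
by apply: (mulgI (wreath_hom u)); rewrite -wreath_homM !mulgV wreath_hom1.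
Qed.

Lemma wreath_homX u k : wreath_hom (u ^+ k) = wreath_hom u ^+ k.
Proof.
by elim: k => [|k IH]; rewrite ?wreath_hom1 // !expgS wreath_homM IH.
Qed.

End WreathHom.

(** * Generators of the image *)

Section Generators.
Local Open Scope group_scope.
Variables (G : groupType) (a b : G).
Hypothesis lamp_comm : forall n, commute a (lamp_at a b n).

Fact lamp_gen_restricted :
  ((fun i => Posz ((i : int) == 0%R), 0%R : int) : unrestricted_wreath Zm Zm)
    \in @restricted Zm Zm.
Proof.
apply/asboolP; apply: (@sub_finite_set _ _ [set (0%R : int)]);
  last exact: finite_set1.
by move=> i /=; case: eqP.
Qed.

Fact shift_gen_restricted :
  ((fun=> 0%R : int, 1%R : int) : unrestricted_wreath Zm Zm) \in @restricted Zm Zm.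
Proof.
apply/asboolP; apply: (@sub_finite_set _ _ set0); last exact: finite_set0.
by move=> i /=.
Qed.

Definition lamp_gen : ZwrZ := Wreath lamp_gen_restricted.
Definition shift_gen : ZwrZ := Wreath shift_gen_restricted.

Lemma wreath_hom_lamp_gen : wreath_hom a b lamp_gen = a.
Proof.
rewrite (wreath_homE lamp_comm (s := [:: 0%R])) //.
  by rewrite /lamps big_seq1 /= mulg1 /lamp_at oppr0 conjg1.
by move=> i; rewrite /lamp /= inE; case: eqP.
Qed.

Lemma wreath_hom_shift_gen : wreath_hom a b shift_gen = b.
Proof.
rewrite (wreath_homE lamp_comm (s := [::])) //.
by rewrite /lamps big_nil mul1g.
Qed.

Lemma range_wreath_hom : generates [:: a; b] (range (wreath_hom a b)).
Proof.
apply/seteqP; split.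
  move=> _ [n [s [_ sab ->]]]; elim: s sab {n} => [|x s IH] sab.
    by rewrite big_nil; exists 1; rewrite // wreath_hom1.
  rewrite big_cons; have [y ys|u _ <-] := IH.
    by apply: sab; rewrite inE ys orbT.
  suff [v _ <-] : range (wreath_hom a b) x by exists (v * u); rewrite // wreath_homM.
  have ab y : y \in [:: a; b] -> range (wreath_hom a b) y.
    rewrite !inE => /orP[]/eqP->.
      by exists lamp_gen; rewrite // wreath_hom_lamp_gen.
    by exists shift_gen; rewrite // wreath_hom_shift_gen.
  have /orP[/ab//|/ab[v _ vx]] := sab x (mem_head _ _).
  by exists v^-1; rewrite // wreath_homV // vx invgK.
have ga : generated [:: a; b] a by apply: generated_mem; rewrite inE eqxx.
have gb : generated [:: a; b] b by apply: generated_mem; rewrite !inE eqxx orbT.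
move=> _ [u _ <-]; apply: generatedM; last exact: generated_zpow.
rewrite /lamps; elim: lamp_supp => [|i s IH].
  by rewrite big_nil; exact: generated1.
rewrite big_cons; apply: generatedM => //; apply: generated_zpow.
rewrite /lamp_at conjgE; apply: generatedM; first exact/generatedV/generated_zpow.
by apply: generatedM => //; exact: generated_zpow.
Qed.

End Generators.

(* The sum of all the lamps. *)
Definition augmentation : ZwrZ -> Zm := @wreath_hom Zm (1%R : int) (0%R : int).

(** The commutation hypothesis of [wreath_hom] in the abelian group Z; it makes [augmentation] a
    homomorphism. *)
Lemma augmentation_comm (n : int) :
  commute (1%R : Zm) (lamp_at (1%R : Zm) (0%R : Zm) n).
Proof. exact: addrC. Qed.

(** * Quadratic distortion from commutators of powers *)

Section Distorted.
Local Open Scope group_scope.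
Variables (G : groupType) (a b : G).
Hypothesis lamp_comm : forall n, commute a (lamp_at a b n).

(** The element C = A_0 A_1^-1, with A_i standing for [lamp_at a b i]. *)
Definition lamp_diff : G := a * (a ^ b^-1)^-1.

Lemma lamp_at_diff n :
  lamp_at lamp_diff b n = lamp_at a b n * (lamp_at a b (n + 1))^-1.
Proof.
have -> : lamp_diff = lamp_at a b 0 * (lamp_at a b 1)^-1.
  by rewrite /lamp_diff /lamp_at oppr0 conjg1.
by rewrite {1}/lamp_at conjMg conjVg !lamp_atJ add0r addrC.
Qed.

Lemma lamp_diff_comm n : commute lamp_diff (lamp_at lamp_diff b n).
Proof.
have c := lamp_at_comm lamp_comm.
have d0 : lamp_at lamp_diff b 0 = lamp_diff by rewrite /lamp_at oppr0 conjg1.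
rewrite -{1}d0 !lamp_at_diff.
apply: commuteM; last apply: commuteV;
  apply/commute_sym/commuteM; try exact: c; apply: commuteV; exact: c.
Qed.

(** Equal to the product over j < l of t^j c^l t^-j, with c the lamp and t the shift: lamps 0, ...,
    l - 1 have value l and the cursor is back at 0. This closed form is easy to evaluate under a
    homomorphism. *)
Definition commutator_preimage (l : nat) : ZwrZ :=
  (lamp_gen ^+ l * shift_gen) ^+ l * shift_gen ^- l.

Lemma augmentation_commutator_preimage l : augmentation (commutator_preimage l) = Posz (l * l).
Proof.
have c := augmentation_comm.
rewrite /augmentation /commutator_preimage.
rewrite !(wreath_homM, wreath_homX, wreath_homV) //.
rewrite wreath_hom_lamp_gen // wreath_hom_shift_gen //.
have X (x : int) k : (x : Zm) ^+ k = (x *+ k)%R by [].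
rewrite !X -[LHS]/((1 *+ l + 0 : int) *+ l - 0 *+ l : int)%R.
by rewrite mul0rn subr0 addr0 -mulrnA natz.
Qed.

Lemma wreath_hom_commutator_preimage l :
  wreath_hom lamp_diff b (commutator_preimage l) = a ^+ l * b ^+ l * a ^- l * b ^- l.
Proof.
have c := lamp_diff_comm.
rewrite /commutator_preimage !(wreath_homM, wreath_homX, wreath_homV) //.
rewrite wreath_hom_lamp_gen // wreath_hom_shift_gen //.
congr (_ * _).
(* As [a] commutes with b a b^-1, C^l = a^l b a^-l b^-1. Hence C^l b is the conjugate a^l b a^-l of
   [b], whose l-th power is a^l b^l a^-l. *)
have -> : lamp_diff ^+ l * b = b ^ (a ^- l).
  rewrite /lamp_diff expgMn; last first.
    apply: commuteV; have := lamp_comm 1.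
    by rewrite /lamp_at.
  by rewrite expVgn -conjXg !conjgE !(invgK, invgM) !mulgA mulgVK.
by rewrite -conjXg conjgE invgK mulgA.
Qed.

(** Augmentation is additive, so each letter adds at most [E] in absolute value; injectivity
    identifies [u] with the product of the preimages of the letters. *)
Lemma spelled_wreath_hom (S : seq G) n w (E : nat) :
  injective (wreath_hom lamp_diff b) ->
  (forall x u, x \in S -> wreath_hom lamp_diff b u = x ->
    `|augmentation u : int| <= E) ->
  (forall x, x \in S -> range (wreath_hom lamp_diff b) x) ->
  spelled S n w -> forall u, wreath_hom lamp_diff b u = w -> 
  (`|augmentation u : int| <= n * E)%N.
Proof.
have c := lamp_diff_comm.
have eM := @wreath_homM Zm (1%R : int) (0%R : int) augmentation_comm.
have eV := @wreath_homV Zm (1%R : int) (0%R : int) augmentation_comm.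
move=> inj SE SR [s [<- sS ->]] u; elim: s sS u => [|x s IH] sS u.
  rewrite big_nil -(wreath_hom1 c) => /inj->.
  by rewrite /augmentation wreath_hom1 //; exact: augmentation_comm.
rewrite big_cons => uE.
have [v vx vE] :
    exists2 v, wreath_hom lamp_diff b v = x & `|augmentation v : int| <= E.
  have /orP[xS|xS] := sS x (mem_head _ _).
    by have [v _ vx] := SR _ xS; exists v => //; exact: SE vx.
  have [v _ vx] := SR _ xS; exists v^-1; first by rewrite wreath_homV // vx invgK.
  rewrite /augmentation eV.
  have := SE _ _ xS vx; rewrite /augmentation; move: (wreath_hom _ _ _) => y.
  by rewrite -[y^-1]/(- (y : int))%R abszN.
have -> : u = v * (v^-1 * u) by rewrite mulVKg.
have /IH : forall y, y \in s -> (y \in S) || (y^-1 \in S).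
  by move=> y ys; apply: sS; rewrite inE ys orbT.
move=> /(_ (v^-1 * u)); rewrite wreath_homM // wreath_homV // uE vx mulKg.
move=> /(_ erefl) sE.
rewrite {1}/augmentation eM mulSn; apply: leq_trans (leq_add vE sE).
have dist (p q : int) : `|((p : Zm) * q)%g : int| <= `|p| + `|q|.
  by rewrite -[(p : Zm) * q]/(p + q)%R; lia.
exact: dist.
Qed.

Lemma wreath_hom_distorted :
  injective (wreath_hom lamp_diff b) -> finitely_generated [set: G] ->
  distorted (range (wreath_hom lamp_diff b)).
Proof.
move=> inj fG; split=> //.
  by exists [:: lamp_diff; b]; apply: range_wreath_hom; exact: lamp_diff_comm.
move=> T S genT genS [[C C0 le] _].
have SR x : x \in S -> range (wreath_hom lamp_diff b) x.
  by move=> xS; rewrite -genS; apply: generated_mem.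
(* [g] takes the augmentation of a chosen preimage, with default 1 outside the image. By injectivity
   the preimage is unique, so [E] bounds the augmentation of the preimage of every generator. *)
pose g x : nat :=
  `|augmentation (xget 1%g [set u | wreath_hom lamp_diff b u = x]) : int|%N.
pose E := \max_(x <- S) g x.
have SE x u : x \in S -> wreath_hom lamp_diff b u = x ->
    `|augmentation u : int| <= E.
  move=> xS ux; have -> : `|augmentation u : int| = g x.
    rewrite /g; case: xgetP => [v _ vx|/(_ u)//].
    by congr (`|augmentation _ : int|%N); apply: inj; rewrite vx.
  by apply: leq_bigmax_seq.
have [m Ta] : generated T a by rewrite genT.
have [n Tb] : generated T b by rewrite genT.
(* One more than the bound on l that linear distortion with constant [C] would force. The factor 2
   (m + n) bounds the cost in [T] of [a^l, b^l], per unit of l. *)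
pose l := (E * (C * (C * (2 * (m + n))))).+1.
have Tl : spelled T (l * (2 * (m + n)))%N (wreath_hom lamp_diff b (commutator_preimage l)).
  rewrite wreath_hom_commutator_preimage.
  have -> : (l * (2 * (m + n)) = l * m + l * n + l * m + l * n)%N by lia.
  by do 3?[apply: spelledM]; try apply: spelledV; apply: spelledX.
have Sl : generated S (wreath_hom lamp_diff b (commutator_preimage l)).
  by rewrite genS; exists (commutator_preimage l).
have [Sl' _] := word_lengthP Sl.
have := spelled_wreath_hom inj SE SR Sl' erefl; rewrite augmentation_commutator_preimage absz_nat.
have [_ ub] := distortionP (l * (2 * (m + n)))%N genT genS.
have Dl : word_length S (wreath_hom lamp_diff b (commutator_preimage l)) <=
    distortion T S (range (wreath_hom lamp_diff b)) (l * (2 * (m + n)))%N.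
  apply: ub; exists (wreath_hom lamp_diff b (commutator_preimage l)) => //.
  split; first by exists (commutator_preimage l).
  exact: word_length_le.
have := leq_trans Dl (le _) => nl ll.
(* The augmentation l^2 is at most [E] times the word length in [S], itself at most C (C l 2 (m +
   n)). Cancelling l gives l <= l - 1. *)
have : (l * l <= l * (E * (C * (C * (2 * (m + n))))))%N by nia.
by rewrite leq_pmul2l // ltnn.
Qed.

End Distorted.

(** * Elements of Thompson's group *)

Local Open Scope ring_scope.

(** * The action on the real line *)

Section Action.
Variable R : realType.
Implicit Types (g h : thompson R) (x y : R).

(* Extending by the identity outside [0, 1] gives an action on all of R, which
   avoids carrying membership proofs around. *)
Definition act g x : R := if 0 <= x <= 1 then ext (thompson_val g) x else x.

Lemma act_val g (y : I01 R) : act g (I01_val y) = I01_val (thompson_val g y).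
Proof. by rewrite /act I01_bounds extE. Qed.

Lemma act_in g x (x01 : 0 <= x <= 1) :
  act g x = I01_val (thompson_val g (I01_sub x01)).
Proof. by rewrite -act_val. Qed.

Lemma act_out g x : ~~ (0 <= x <= 1) -> act g x = x.
Proof. by rewrite /act => /negPf->. Qed.

Lemma act_bounds g x : (0 <= act g x <= 1) = (0 <= x <= 1).
Proof.
have [x01|xN] := boolP (0 <= x <= 1); first by rewrite (act_in g x01) I01_bounds.
by rewrite act_out // (negPf xN).
Qed.

Lemma actM g h x : act (g * h)%g x = act g (act h x).
Proof.
have [x01|xN] := boolP (0 <= x <= 1); last by rewrite !act_out.
by rewrite !(act_in _ x01) act_val.
Qed.

Lemma act1 x : act 1%g x = x.
Proof.
by have [x01|/act_out//] := boolP (0 <= x <= 1); rewrite (act_in _ x01).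
Qed.

Lemma actK g : cancel (act g) (act g^-1%g).
Proof. by move=> x; rewrite -actM mulVg act1. Qed.

Lemma actVK g : cancel (act g^-1%g) (act g).
Proof. by move=> x; rewrite -actM mulgV act1. Qed.

Lemma act_ext g h : (forall x, 0 <= x <= 1 -> act g x = act h x) -> g = h.
Proof.
move=> gh; apply/val_inj/homeoP => y; apply: I01_inj.
by rewrite -!act_val gh // I01_bounds.
Qed.

Lemma act_lt g : {homo act g : x y / x < y}.
Proof.
move=> x y xy; have [x01|xN] := boolP (0 <= x <= 1);
  have [y01|yN] := boolP (0 <= y <= 1).
- rewrite (act_in g x01) (act_in g y01).
  by case: g => f /= /asboolP[incr _]; apply: incr.
- by have := act_bounds g x; rewrite x01 (act_out g yN); lra.
- by have := act_bounds g y; rewrite y01 (act_out g xN); lra.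
- by rewrite !act_out.
Qed.

Lemma act_le g : {mono act g : x y / x <= y}.
Proof. exact/le_mono/act_lt. Qed.

Lemma act_ltE g : {mono act g : x y / x < y}.
Proof. exact/leW_mono/act_le. Qed.

(** [I01] carries the initial topology of its inclusion into R, so continuity of a map into it can
    be tested after composing with the inclusion. *)
Lemma continuous_I01 (f : R -> R) (F : I01 R -> I01 R) :
  continuous f -> (forall y : I01 R, I01_val (F y) = f (I01_val y)) ->
  continuous F.
Proof.
move=> cf Ff.
have cv : continuous (@I01_val R) by exact: initial_continuous.
have cc : continuous (@I01_val R \o F).
  have -> : @I01_val R \o F = f \o @I01_val R by apply/funext => y; apply: Ff.
  by move=> x; apply: continuous_comp; [exact: cv|exact: cf].
exact: (continuous_comp_initial cc).
Qed.

Definition pl_on (f : R -> R) (s : seq R) := forall a b : R, a < b ->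
  (forall c, c \in s -> ~~ (a < c < b)) ->
  exists k : int, forall x, a <= x <= b -> f x = f a + 2 ^ k * (x - a).

(** A strictly increasing bijection fixing 0 and 1 preserves [0, 1], as does its inverse, so both
    restrict to [I01]. *)
Lemma thompson_of (f f' : R -> R) (s : seq R) :
  cancel f f' -> cancel f' f -> continuous f -> continuous f' ->
  {homo f : x y / x < y} -> f 0 = 0 -> f 1 = 1 ->
  (forall c, c \in s -> dyadic c) -> pl_on f s ->
  exists g : thompson R, forall x, 0 <= x <= 1 -> act g x = f x.
Proof.
move=> fK f'K cf cf' incr f0 f1 sdy fpl.
have mono := le_mono incr.
have F01 (x : I01 R) : 0 <= f (I01_val x) <= 1.
  by rewrite -{1}f0 -f1 !mono I01_bounds.
have F'01 (x : I01 R) : 0 <= f' (I01_val x) <= 1.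
  by rewrite -(mono 0) -(mono _ 1) f0 f1 f'K I01_bounds.
pose F (x : I01 R) : I01 R := I01_sub (F01 x).
pose F' (x : I01 R) : I01 R := I01_sub (F'01 x).
have FK : cancel F F' by move=> x; apply: I01_inj; exact: fK.
have F'K : cancel F' F by move=> x; apply: I01_inj; exact: f'K.
have cF : continuous F by apply: (continuous_I01 cf).
have cF' : continuous F' by apply: (continuous_I01 cf').
have FT : Homeo FK F'K cF cF' \in @in_thompson R.
  apply/asboolP; split; first by move=> x y /incr.
  exists s => // a b ab abs; have [k kP] := fpl _ _ ab abs.
  by exists k => x /kP.
by exists (Thompson FT) => x x01; rewrite (act_in _ x01).
Qed.

(** * Elements supported in a dyadic interval *)

Section Bump.
Variables c d : R.
Hypotheses (cd : c < d) (c0 : 0 <= c) (d1 : d <= 1).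
Hypotheses (dyc : dyadic c) (dyd : dyadic d).

(** A copy of x_0 rescaled to [c, d]: slopes 2, 1, 1/2 with breaks at the quarter point and the
    midpoint, and the identity outside. The lattice form makes continuity immediate. *)
Definition bump_fun x :=
  Num.max x (Num.min (2 * x - c) (Num.min (x + (d - c) / 4) ((x + d) / 2))).

Definition bump_inv x :=
  Num.min x (Num.max ((x + c) / 2) (Num.max (x - (d - c) / 4) (2 * x - d))).

(** The five affine pieces, as a case split that leaves linear arithmetic. *)
Lemma bump_funP x :
  [\/ x <= c /\ bump_fun x = x,
      c <= x <= c + (d - c) / 4 /\ bump_fun x = 2 * x - c,
      c + (d - c) / 4 <= x <= (c + d) / 2 /\ bump_fun x = x + (d - c) / 4 |
      ((c + d) / 2 <= x <= d /\ bump_fun x = (x + d) / 2) \/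
      (d <= x /\ bump_fun x = x)].
Proof.
have H : d - c > 0 by rewrite subr_gt0.
rewrite /bump_fun; case: (leP x (Num.min _ _));
  case: (leP (2 * x - c) (Num.min _ _)); case: (leP (x + (d - c) / 4) _) => h1 h2 h3;
  first [by constructor 1; split=> //; lra
  | by constructor 2; split=> //; apply/andP; split; lra
  | by constructor 3; split=> //; apply/andP; split; lra
  | by constructor 4; left; split=> //; apply/andP; split; lra
  | by constructor 4; right; split=> //; lra | by exfalso; lra].
Qed.

Lemma bump_invP x :
  [\/ x <= c /\ bump_inv x = x,
      c <= x <= (c + d) / 2 /\ bump_inv x = (x + c) / 2,
      (c + d) / 2 <= x <= d - (d - c) / 4 /\ bump_inv x = x - (d - c) / 4 |
      (d - (d - c) / 4 <= x <= d /\ bump_inv x = 2 * x - d) \/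
      (d <= x /\ bump_inv x = x)].
Proof.
have H : d - c > 0 by rewrite subr_gt0.
rewrite /bump_inv; case: (leP x (Num.max _ _));
  case: (leP ((x + c) / 2) (Num.max _ _));
  case: (leP (x - (d - c) / 4) _) => h1 h2 h3;
  first [by constructor 1; split=> //; lra
  | by constructor 2; split=> //; apply/andP; split; lra
  | by constructor 3; split=> //; apply/andP; split; lra
  | by constructor 4; left; split=> //; apply/andP; split; lra
  | by constructor 4; right; split=> //; lra | by exfalso; lra].
Qed.

Lemma bump_funK : cancel bump_fun bump_inv.
Proof.
move=> x; have H : d - c > 0 by rewrite subr_gt0.
by case: (bump_funP x) => [[? e]|[? e]|[? e]|[[? e]|[? e]]];
  case: (bump_invP (bump_fun x)) => [[? ->]|[? ->]|[? ->]|[[? ->]|[? ->]]]; lra.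
Qed.

Lemma bump_invK : cancel bump_inv bump_fun.
Proof.
move=> x; have H : d - c > 0 by rewrite subr_gt0.
by case: (bump_invP x) => [[? e]|[? e]|[? e]|[[? e]|[? e]]];
  case: (bump_funP (bump_inv x)) => [[? ->]|[? ->]|[? ->]|[[? ->]|[? ->]]]; lra.
Qed.

Lemma bump_fun_incr : {homo bump_fun : x y / x < y}.
Proof.
move=> x y xy; have H : d - c > 0 by rewrite subr_gt0.
by case: (bump_funP x) => [[? ->]|[? ->]|[? ->]|[[? ->]|[? ->]]];
  case: (bump_funP y) => [[? ->]|[? ->]|[? ->]|[[? ->]|[? ->]]]; lra.
Qed.

Lemma affine_continuous (p q : R) : continuous (fun x : R => p * x + q).
Proof.
by move=> x; apply: cvgD; [apply: cvgM; [exact: cvg_cst|exact: cvg_id]|exact: cvg_cst].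
Qed.

Lemma bump_fun_cont : continuous bump_fun.
Proof.
have -> : bump_fun = (fun x : R => 1 * x + 0) \max ((fun x => 2 * x + (- c)) \min
    ((fun x => 1 * x + (d - c) / 4) \min (fun x => 2^-1 * x + d / 2))).
  apply/funext => x /=; rewrite /bump_fun.
  by congr (Num.max _ (Num.min _ (Num.min _ _))); lra.
by move=> x; apply: continuous_max; last apply: continuous_min; last apply: continuous_min;
  exact: affine_continuous.
Qed.

Lemma bump_inv_cont : continuous bump_inv.
Proof.
have -> : bump_inv = (fun x : R => 1 * x + 0) \min ((fun x => 2^-1 * x + c / 2) \max
    ((fun x => 1 * x + (- ((d - c) / 4))) \max (fun x => 2 * x + (- d)))).
  apply/funext => x /=; rewrite /bump_inv.
  by congr (Num.min _ (Num.max _ (Num.max _ _))); lra.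
by move=> x; apply: continuous_min; last apply: continuous_max; last apply: continuous_max;
  exact: affine_continuous.
Qed.

Lemma bump_fun_left x : x <= c -> bump_fun x = x.
Proof. by case: (bump_funP x) => [[? ->]|[? ->]|[? ->]|[[? ->]|[? ->]]]; lra. Qed.

Lemma bump_fun_right x : d <= x -> bump_fun x = x.
Proof. by case: (bump_funP x) => [[? ->]|[? ->]|[? ->]|[[? ->]|[? ->]]]; lra. Qed.

Lemma bump_fun1 x : c <= x <= c + (d - c) / 4 -> bump_fun x = 2 * x - c.
Proof. by case: (bump_funP x) => [[? ->]|[? ->]|[? ->]|[[? ->]|[? ->]]]; lra. Qed.

Lemma bump_fun2 x : c + (d - c) / 4 <= x <= (c + d) / 2 ->
  bump_fun x = x + (d - c) / 4.
Proof. by case: (bump_funP x) => [[? ->]|[? ->]|[? ->]|[[? ->]|[? ->]]]; lra. Qed.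

Lemma bump_fun3 x : (c + d) / 2 <= x <= d -> bump_fun x = (x + d) / 2.
Proof. by case: (bump_funP x) => [[? ->]|[? ->]|[? ->]|[[? ->]|[? ->]]]; lra. Qed.

Lemma bump_fun_pl : pl_on bump_fun [:: c; c + (d - c) / 4; (c + d) / 2; d].
Proof.
move=> a b ab abs.
(* A breakpoint left of [b] is also left of [a] or equal to it. Scanning the breakpoints from the
   left thus finds the single piece containing [a, b]. *)
have gap e : e \in [:: c; c + (d - c) / 4; (c + d) / 2; d] -> e < b -> e <= a.
  by move=> /abs; rewrite negb_and -!leNgt => /orP[//|be] /(le_lt_trans be); rewrite ltxx.
have [b1|/gap] := leP b c; last rewrite inE eqxx => /(_ isT) a1.
  exists 0 => x /andP[ax xb]; rewrite expr0z !bump_fun_left //; lra.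
have [b2|/gap] := leP b (c + (d - c) / 4); last rewrite !inE eqxx orbT => /(_ isT) a2.
  exists 1 => x /andP[ax xb]; rewrite expr1z !bump_fun1; lra.
have [b3|/gap] := leP b ((c + d) / 2); last rewrite !inE eqxx !orbT => /(_ isT) a3.
  exists 0 => x /andP[ax xb]; rewrite expr0z !bump_fun2; lra.
have [b4|/gap] := leP b d; last rewrite !inE eqxx !orbT => /(_ isT) a4.
  exists (- 1) => x /andP[ax xb]; rewrite exprN1 !bump_fun3; lra.
exists 0 => x /andP[ax xb]; rewrite expr0z !bump_fun_right //; lra.
Qed.

Lemma bump_exists : exists g : thompson R, forall x, act g x = bump_fun x.
Proof.
have H : d - c > 0 by rewrite subr_gt0.
have out x : ~~ (0 <= x <= 1) -> bump_fun x = x.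
  rewrite negb_and -!ltNge => /orP[x0|x1].
    exact: bump_fun_left (ltW (lt_le_trans x0 c0)).
  exact: bump_fun_right (ltW (le_lt_trans d1 x1)).
have [||c' c's|g gP] := thompson_of bump_funK bump_invK bump_fun_cont bump_inv_cont
    bump_fun_incr _ _ _ bump_fun_pl.
- exact: bump_fun_left.
- exact: bump_fun_right.
- have half x : dyadic x -> dyadic (x / 2).
    by move=> /(@dyadic_pow2 R (- 1)); rewrite exprN1 mulrC.
  have dcd := dyadicD dyc dyd.
  have q : dyadic (c + (d - c) / 4).
    (* The quarter point is an iterated midpoint, so sums and halves suffice. *)
    have -> : c + (d - c) / 4 = (c + (c + d) / 2) / 2 by lra.
    by apply/half/dyadicD/half.
  by move: c's; rewrite !inE => /or4P[] /eqP-> //; exact: half.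
exists g => x; have [/gP//|xN] := boolP (0 <= x <= 1).
by rewrite act_out // out.
Qed.

End Bump.
End Action.

(** * Finite generation of Thompson's group *)

Section Subdivision.
Local Open Scope nat_scope.

(* A subdivision into standard dyadic intervals, scaled up to natural numbers:
   an interval of length 2 ^ d must start at a multiple of 2 ^ d. *)
Fixpoint aligned (p : nat) (ds : seq nat) : bool :=
  if ds is d :: ds' then (2 ^ d %| p) && aligned (p + 2 ^ d) ds' else true.

Definition total_width (ds : seq nat) := \sum_(d <- ds) 2 ^ d.

Lemma total_width_nil : total_width [::] = 0.
Proof. exact: big_nil. Qed.

Lemma total_width_cons d ds : total_width (d :: ds) = 2 ^ d + total_width ds.
Proof. exact: big_cons. Qed.

Lemma total_width_cat ds es : total_width (ds ++ es) = total_width ds + total_width es.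
Proof. exact: big_cat. Qed.

Lemma aligned_cat p ds es :
  aligned p (ds ++ es) = aligned p ds && aligned (p + total_width ds) es.
Proof.
elim: ds p => [|d ds IH] p /=; first by rewrite total_width_nil addn0.
by rewrite IH total_width_cons addnA andbA.
Qed.

(** An interval of length 2^d with d <= K has endpoints divisible by 2^d, so the multiple [q] of
    2^K, also divisible by 2^d, cannot lie strictly inside it. *)
Lemma aligned_cut p ds K q : aligned p ds -> {in ds, forall d, d <= K} ->
  2 ^ K %| q -> p <= q <= p + total_width ds ->
  exists l r, ds = l ++ r /\ p + total_width l = q.
Proof.
elim: ds p => [|d ds IH] p /=.
  rewrite total_width_nil addn0 => _ _ _ pq; exists [::], [::].
  by rewrite total_width_nil; split=> //; lia.
move=> /andP[dp ad] dK Kq; rewrite total_width_cons => /andP[pq qt].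
have [<-|npq] := eqVneq p q; first by
  exists [::], (d :: ds); rewrite total_width_nil addn0.
have dq : 2 ^ d %| q.
  by apply: dvdn_trans Kq; apply: dvdn_exp2l; apply: dK; rewrite mem_head.
have pdq : p + 2 ^ d <= q.
  have : 2 ^ d %| q - p by apply: dvdn_sub.
  by move=> /dvdn_leq; lia.
have [|||l [r [-> <-]]] := IH _ ad => //.
- by move=> e eds; apply: dK; rewrite inE eds orbT.
- by rewrite pdq -addnA.
by exists (d :: l), r; rewrite total_width_cons addnA.
Qed.

(** Every aligned subdivision of an interval of length 2^K arises from that interval by successive
    halvings: if it has several pieces, the midpoint is one of its cut points, and the two halves
    are treated recursively. The context [s], [t] lets one half be refined while the other is
    kept. *)
Lemma aligned_ind (P : seq nat -> Prop) :
  (forall s d t, P (s ++ d.+1 :: t) -> P (s ++ d :: d :: t)) ->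
  forall K p ds s t, 2 ^ K %| p -> aligned p ds -> total_width ds = 2 ^ K ->
  P (s ++ K :: t) -> P (s ++ ds ++ t).
Proof.
move=> Psplit; elim=> [|K IH] p [|d [|e ds]] s t Kp.
- by rewrite total_width_nil.
- rewrite total_width_cons total_width_nil; case: d => //= d _.
  by rewrite expnS; have := expn_gt0 2 d; lia.
- by rewrite !total_width_cons; have := expn_gt0 2 d; have := expn_gt0 2 e; lia.
- by rewrite total_width_nil; have := expn_gt0 2 K.+1; lia.
- rewrite total_width_cons total_width_nil addn0 => _ /eqP.
  by rewrite eqn_exp2l // => /eqP->.
set es := d :: e :: ds => aes tes PK.
(* Two or more positive lengths add up to 2^(K+1), so each is smaller than 2^(K+1). *)
have small : {in es, forall x, x <= K}.
  have tpos x r : 0 < total_width (x :: r).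
    by rewrite total_width_cons; have := expn_gt0 2 x; lia.
  have xle x r : x \in r -> 2 ^ x <= total_width r.
    by case/splitPr => r1 r2; rewrite total_width_cat total_width_cons; lia.
  move=> x; rewrite -ltnS -(ltn_exp2l _ _ (ltnSn 1)) -tes total_width_cons inE.
  case/orP => [/eqP->|/xle]; first by have := tpos e ds; lia.
  by have := expn_gt0 2 d; lia.
have pow : 2 ^ K.+1 = 2 ^ K + 2 ^ K by rewrite expnS mul2n addnn.
have Kp' : 2 ^ K %| p by apply: dvdn_trans Kp; rewrite dvdn_exp2l.
have [||l [r [E tl]]] := @aligned_cut p es K (p + 2 ^ K) aes small.
- by rewrite dvdn_addr.
- by rewrite tes; lia.
move: aes tes; rewrite E aligned_cat total_width_cat => /andP[al ar] tes.
(* Read backwards: halve the interval, refine its right half into [r], then its left half into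
   [l]. *)
rewrite -catA; apply: (IH p) => //; first by lia.
rewrite -cat_rcons; apply: (IH (p + total_width l)) => //.
  by rewrite tl dvdn_addr.
  by lia.
by rewrite cat_rcons; apply: Psplit.
Qed.

End Subdivision.

(** * Maps affine between two subdivisions *)

Section PiecewiseAffine.
Variable R : realType.
Implicit Types (f : R -> R) (a b c w v : R) (ws vs us : seq R) (g h : thompson R).

(* [f] maps the consecutive intervals of lengths [ws] starting at [a] affinely
   onto the consecutive intervals of lengths [vs] starting at [b]. *)
Fixpoint aff f a b ws vs : Prop :=
  match ws, vs with
  | [::], [::] => True
  | w :: ws', v :: vs' =>
    [/\ 0 < w, 0 < v,
        forall x, a <= x <= a + w -> f x = b + v / w * (x - a) &
        aff f (a + w) (b + v) ws' vs']
  | _, _ => False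
  end.

Lemma aff_comp f f' a b c ws vs us : aff f a b ws vs -> aff f' b c vs us ->
  aff (f' \o f) a c ws us.
Proof.
elim: ws a b c vs us => [|w ws IH] a b c [|v vs] [|u us] //=.
move=> [w0 v0 fP fr] [_ u0 f'P f'r]; split=> //; last exact: IH f'r.
move=> x xa; rewrite fP // f'P; last first.
  have p : 0 <= v / w * (x - a).
    by apply: mulr_ge0; [exact: divr_ge0 (ltW v0) (ltW w0)|lra].
  have q : v / w * (x - a) <= v.
    by rewrite mulrAC ler_pdivrMr // ler_pM2l //; lra.
  by apply/andP; split; lra.
by field; rewrite !gt_eqF.
Qed.

(** The right endpoint is excluded because [aff] with empty lists says nothing about the value at
    [a]. *)
Lemma aff_eq f f' a b ws vs : aff f a b ws vs -> aff f' a b ws vs ->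
  forall x, a <= x < a + \sum_(w <- ws) w -> f x = f' x.
Proof.
elim: ws a b vs => [|w ws IH] a b [|v vs] //=.
  by move=> _ _ x; rewrite big_nil; lra.
move=> [w0 v0 fP fr] [_ _ f'P f'r] x; rewrite big_cons addrA => /andP[ax xw].
have [xaw|awx] := leP x (a + w); first by rewrite fP ?f'P ?ax.
by apply: IH fr f'r _ _; rewrite xw ltW.
Qed.

Lemma aff_size f a b ws vs : aff f a b ws vs -> size ws = size vs.
Proof.
by elim: ws a b vs => [|w ws IH] a b [|v vs] //= [_ _ _ /IH->].
Qed.

Fixpoint halve_nth (i : nat) ws {struct ws} : seq R :=
  match ws, i with
  | [::], _ => [::]
  | w :: ws', 0%N => w / 2 :: w / 2 :: ws'
  | w :: ws', i'.+1 => w :: halve_nth i' ws'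
  end.

(** An affine piece sends midpoint to midpoint, so the same piece may be halved on both sides. *)
Lemma aff_halve f a b ws vs i : aff f a b ws vs ->
  aff f a b (halve_nth i ws) (halve_nth i vs).
Proof.
elim: ws a b vs i => [|w ws IH] a b [|v vs] [|i] //= [w0 v0 fP fr]; last first.
  by split=> //; exact: IH.
have w2 : 0 < w / 2 by lra.
have v2 : 0 < v / 2 by lra.
have vw : v / 2 / (w / 2) = v / w by field; rewrite gt_eqF.
have e2 (x : R) : x / 2 + x / 2 = x by lra.
rewrite vw; split=> //.
  by move=> x xa; apply: fP; lra.
split=> //; last by rewrite -!addrA !e2.
move=> x xa; rewrite fP; last by lra.
by field; rewrite gt_eqF.
Qed.

(* Lengths of the intervals of the subdivision a, a + w/2, a + 3w/4, ... *)
Fixpoint vine w (n : nat) : seq R :=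
  if n is n'.+1 then w / 2 :: vine (w / 2) n' else [:: w].

Lemma aff_vine f a b w v n : 0 < w -> 0 < v ->
  (forall x, a <= x <= a + w -> f x = b + v / w * (x - a)) ->
  aff f a b (vine w n) (vine v n).
Proof.
move=> w0 v0 fP; elim: n a b w v w0 v0 fP => [|n IH] a b w v w0 v0 fP //=.
have w2 : 0 < w / 2 by lra.
have v2 : 0 < v / 2 by lra.
have vw : v / 2 / (w / 2) = v / w by field; rewrite gt_eqF.
rewrite vw; split=> //; first by move=> x xa; apply: fP; lra.
apply: IH => // x xa; rewrite fP; last by lra.
by rewrite vw; field; rewrite gt_eqF.
Qed.

Lemma vine_half w n : [seq x / 2 | x <- vine w n] = vine (w / 2) n.
Proof. by elim: n w => //= n IH w; rewrite IH. Qed.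

Lemma halve_nth_half ws i :
  [seq x / 2 | x <- halve_nth i ws] = halve_nth i [seq x / 2 | x <- ws].
Proof. by elim: ws i => //= w ws IH [|i] //=; rewrite IH. Qed.

Lemma halve_last_vine w n : halve_nth n (vine w n) = vine w n.+1.
Proof. by elim: n w => //= n IH w; rewrite IH. Qed.

Lemma halve_nth_cat ws w vs :
  halve_nth (size ws) (ws ++ w :: vs) = ws ++ w / 2 :: w / 2 :: vs.
Proof. by elim: ws => //= u ws ->. Qed.

(** [f'] is [f] shrunk by x -> (1 + x) / 2 onto the right half. Each of the generators x_0, x_1,
    x_2, ... is related in this way to the next one. *)
Definition right_copy f f' : Prop :=
  (forall x, x <= 1 / 2 -> f' x = x) /\
  (forall x, 1 / 2 <= x -> f' x = (1 + f (2 * x - 1)) / 2).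

Lemma aff_right_copy f f' a b ws vs : right_copy f f' -> 0 <= a ->
  aff f a b ws vs ->
  aff f' ((1 + a) / 2) ((1 + b) / 2) [seq w / 2 | w <- ws] [seq v / 2 | v <- vs].
Proof.
move=> [_ f'P]; elim: ws a b vs => [|w ws IH] a b [|v vs] //= a0.
move=> [w0 v0 fP fr].
have w2 : 0 < w / 2 by lra.
have v2 : 0 < v / 2 by lra.
split=> //.
  move=> x xa; rewrite f'P; last by lra.
  rewrite fP; last by lra.
  by field; rewrite gt_eqF.
have := IH _ _ _ _ fr; rewrite ![(1 + (_ + _)) / 2]mulrDl !mulrDl !addrA; apply.
by lra.
Qed.

End PiecewiseAffine.

(** * Carrying any subdivision to a vine with x_0 and x_1 *)

Section VineReduction.
Variable R : realType.
Variables x0 x1 : thompson R.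
Hypothesis x0P : forall x, act x0 x = bump_fun 0 1 x.
Hypothesis x1P : forall x, act x1 x = bump_fun (1 / 2) 1 x.

Let Gamma := generated [:: x0; x1].

(** The classical infinite generating family of F, written in x_0 and x_1. *)
Fixpoint vine_gen (i : nat) : thompson R :=
  match i with
  | 0 => x0
  | 1 => x1
  | (i'.+1) as j.+1 => (x0 * vine_gen j * x0^-1)%g
  end.

Lemma vine_gen_generated i : Gamma (vine_gen i).
Proof.
have G0 : Gamma x0 by apply: generated_mem; rewrite inE eqxx.
have G1 : Gamma x1 by apply: generated_mem; rewrite !inE eqxx orbT.
elim: i => // -[|i] // IH; apply: generatedM; last exact: generatedV.
exact: generatedM.
Qed.

Lemma act_x0_left x : 0 <= x <= 1 / 4 -> act x0 x = 2 * x.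
Proof. by move=> x01; rewrite x0P bump_fun1; lra. Qed.

Lemma act_x0_mid x : 1 / 4 <= x <= 1 / 2 -> act x0 x = x + 1 / 4.
Proof. by move=> x01; rewrite x0P bump_fun2; lra. Qed.

Lemma act_x0_right x : 1 / 2 <= x <= 1 -> act x0 x = (1 + x) / 2.
Proof. by move=> x01; rewrite x0P bump_fun3; lra. Qed.

Lemma right_copy_x1 : right_copy (act x0) (act x1).
Proof.
split=> x xh; rewrite x1P; first by rewrite bump_fun_left //; lra.
have [h1|h1] := leP x (5 / 8).
  by rewrite act_x0_left ?bump_fun1; lra.
have [h2|h2] := leP x (3 / 4).
  by rewrite act_x0_mid ?bump_fun2; lra.
have [h3|h3] := leP x 1.
  by rewrite act_x0_right ?bump_fun3; lra.
by rewrite act_out ?bump_fun_right; lra.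
Qed.

(** On [1/2, 1] the map x_0 is itself the shrinking x -> (1 + x) / 2, and [h] is the identity left
    of 1/2. Conjugating [h] by x_0 therefore shrinks it once more. *)
Lemma right_copy_conj g h : right_copy (act g) (act h) ->
  right_copy (act h) (act (x0 * h * x0^-1)%g).
Proof.
move=> [hl hr]; split=> x xh; rewrite !actM.
  rewrite hl ?actVK // -(act_le x0) actVK.
  by rewrite act_x0_mid; lra.
(* Up to 3/4 both sides are the identity, since x_0^-1 x and 2 x - 1 are at most 1/2. *)
have [x34|x34] := leP x (3 / 4).
  rewrite !hl ?actVK //; first by lra.
  - by lra.
  - by rewrite -(act_le x0) actVK act_x0_mid; lra.
have [x1'|x1'] := leP x 1; last by rewrite !act_out //; lra.
have -> : act x0^-1%g x = 2 * x - 1.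
  apply: (can_inj (actK x0)); rewrite actVK act_x0_right; lra.
have lo : 1 / 2 <= act h (2 * x - 1).
  by rewrite -{1}(hl (1 / 2)) // act_le; lra.
have up : act h (2 * x - 1) <= 1.
  have b01 : 0 <= 2 * x - 1 <= 1 by lra.
  by have := act_bounds h (2 * x - 1); rewrite b01 => /andP[].
by rewrite act_x0_right // lo.
Qed.

Lemma vine_gen_right_copy i : right_copy (act (vine_gen i)) (act (vine_gen i.+1)).
Proof.
elim: i => [|i IH]; first exact: right_copy_x1.
exact: right_copy_conj IH.
Qed.

(** x_0 turns lengths 1/4, 1/4, 1/2 into 1/2, 1/4, 1/4, the subdivided last interval being mapped
    affinely; passing to right copies gives the later indices. The vine has n + 1 intervals, so i <
    n means that the halved one is not the last. *)
Lemma aff_vine_gen i n : (i < n)%N ->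
  aff (act (vine_gen i)) 0 0 (halve_nth i (vine 1 n)) (vine 1 n.+1).
Proof.
elim: i n => [|i IH] [|n] // lt_in.
  have [a b c] : [/\ (0 : R) < 1 / 2 / 2, (0 : R) < 1 / 2 & (1 / 2 / 2 : R) = 1 / 4].
    by split; lra.
  split=> //.
    by move=> x xa; rewrite act_x0_left; lra.
  split=> //.
    by move=> x xa; rewrite act_x0_mid; lra.
  apply: aff_vine => // x xa; rewrite act_x0_right; lra.
have := aff_right_copy (vine_gen_right_copy i) (lexx 0) (IH _ lt_in).
rewrite halve_nth_half !vine_half addr0 => H.
split; try lra; last by rewrite add0r.
by move=> x xa; have [hl _] := vine_gen_right_copy i; rewrite hl; lra.
Qed.

(** By induction on halvings: halving an interval of the subdivision halves one in the vine, which
    some x_i repairs. A vine of index n has n + 1 intervals, hence the predecessor. *)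
Lemma aligned_vine K ds : aligned 0 ds -> total_width ds = (2 ^ K)%N ->
  exists2 g, Gamma g & aff (act g) 0 0 [seq 2 ^+ d / 2 ^+ K | d <- ds]
                             (vine 1 (size ds).-1).
Proof.
move=> ads tds.
pose P (es : seq nat) := exists2 g, Gamma g &
  aff (act g) 0 0 [seq 2 ^+ d / 2 ^+ K | d <- es] (vine 1 (size es).-1).
suff : P ([::] ++ ds ++ [::]) by rewrite cats0.
apply: (@aligned_ind P _ K 0) => //.
  move=> s d t [g Gg gP].
  have := aff_halve (size s) gP; rewrite map_cat /=.
  rewrite -[X in halve_nth X (_ ++ _)](size_map (fun d => 2 ^+ d / 2 ^+ K : R) s).
  rewrite halve_nth_cat.
  have -> : 2 ^+ d.+1 / 2 ^+ K / 2 = 2 ^+ d / 2 ^+ K :> R.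
    by rewrite exprS; field; rewrite expf_neq0 // pnatr_eq0.
  rewrite size_cat /= addnS /= => gP'.
  have -> : P (s ++ d :: d :: t) = exists2 g, Gamma g &
    aff (act g) 0 0
      ([seq 2 ^+ d / 2 ^+ K | d <- s] ++
        2 ^+ d / 2 ^+ K :: 2 ^+ d / 2 ^+ K :: [seq 2 ^+ d / 2 ^+ K | d <- t])
      (vine 1 (size s + size t).+1).
    by rewrite /P map_cat size_cat /= !addnS.
  (* If [t] is nonempty, the halved interval is not the last and x_(size s) restores a vine; halving
     the last interval already gives one. *)
  have [lt|ge] := ltnP (size s) (size s + size t).
    exists (vine_gen (size s) * g)%g.
      by apply: generatedM => //; exact: vine_gen_generated.
    have -> : act (vine_gen (size s) * g)%g = act (vine_gen (size s)) \o act g.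
      by apply/funext => x; rewrite actM.
    by apply: aff_comp gP' _; exact: aff_vine_gen.
  exists g => //.
  have e : (size s + size t = size s)%N by lia.
  by move: gP'; rewrite e halve_last_vine.
exists 1%g; first exact: generated1.
have -> : act (1%g : thompson R) = id by apply/funext => x; rewrite act1.
rewrite /= divff ?expf_neq0 ?pnatr_eq0 //.
by split; rewrite // => x _; lra.
Qed.

End VineReduction.

(** * Dyadic subdivisions attached to an element of F *)

Section FiniteGeneration.
Variable R : realType.
Variable f : thompson R.

Lemma act_0 : act f 0 = 0.
Proof.
apply/eqP; rewrite eq_le; apply/andP; split.
  rewrite -{2}(actVK f 0) act_le.
  by have := act_bounds f^-1%g 0; rewrite lexx ler01 /= => /andP[].
by have := act_bounds f 0; rewrite lexx ler01 /= => /andP[].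
Qed.

Lemma act_1 : act f 1 = 1.
Proof.
apply/eqP; rewrite eq_le; apply/andP; split.
  by have := act_bounds f 1; rewrite lexx ler01 /= => /andP[].
rewrite -{1}(actVK f 1) act_le.
by have := act_bounds f^-1%g 1; rewrite lexx ler01 /= => /andP[].
Qed.

Lemma act_dyadic x : dyadic x -> dyadic (act f x).
Proof.
have [x01|/act_out->//] := boolP (0 <= x <= 1).
rewrite (act_in f x01); case: f => h /= /asboolP[incr pl] dx.
exact: homeo_dyadic.
Qed.

Lemma dyadic_den (x : R) (m n : nat) : (m <= n)%N ->
  (exists z : int, x = z%:~R / 2 ^+ m) -> exists z : int, x = z%:~R / 2 ^+ n.
Proof.
move=> /subnK <- [z ->]; exists (z * 2 ^+ (n - m)).
rewrite rmorphM rmorphXn /= exprD; field.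
by rewrite !expf_neq0 ?pnatr_eq0.
Qed.

Lemma common_den (s : seq R) : (forall c, c \in s -> dyadic c) ->
  exists m : nat, forall c, c \in s -> exists z : int, c = z%:~R / 2 ^+ m.
Proof.
elim: s => [|c s IH] sdy; first by exists 0%N.
have [d ds|m mP] := IH; first by apply: sdy; rewrite inE ds orbT.
have [z [n cE]] := sdy c (mem_head _ _).
exists (m + n)%N => d; rewrite inE => /orP[/eqP->|/mP].
  by apply: (@dyadic_den _ n); [exact: leq_addl|exists z].
by apply: dyadic_den; exact: leq_addr.
Qed.

Lemma uniform_bound (Q : nat -> nat -> Prop) n :
  (forall i M N, (M <= N)%N -> Q i M -> Q i N) ->
  (forall i, (i < n)%N -> exists N, Q i N) ->
  exists N, forall i, (i < n)%N -> Q i N.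
Proof.
move=> mono; elim: n => [|n IH] ex; first by exists 0%N.
have [i lt_in|N NP] := IH; first by apply: ex; exact: ltnW.
have [M MP] := ex n (ltnSn n).
exists (M + N)%N => i; rewrite ltnS leq_eqVlt => /orP[/eqP->|/NP QN].
  by apply: mono MP; exact: leq_addr.
by apply: mono QN; exact: leq_addl.
Qed.

(** A common denominator 2^m of the breakpoints keeps them out of the interior of the grid cells.
    Enlarging [N] weakens the conditions, so one [N] serves the finitely many cells. *)
Lemma affine_on_grid : exists m N : nat, forall i, (i < 2 ^ m)%N ->
  exists k z : int, [/\ (`|k| <= N)%N, act f (i%:R / 2 ^+ m) = z%:~R / 2 ^+ N &
    forall x, i%:R / 2 ^+ m <= x <= i.+1%:R / 2 ^+ m ->
      act f x = act f (i%:R / 2 ^+ m) + 2 ^ k * (x - i%:R / 2 ^+ m)].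
Proof.
have [s sdy saff] : exists2 s : seq R, (forall c, c \in s -> dyadic c) &
    forall a b : R, 0 <= a -> b <= 1 -> a < b ->
      (forall c, c \in s -> ~~ (a < c < b)) ->
    exists k : int, forall x, a <= x <= b -> act f x = act f a + 2 ^ k * (x - a).
  have /asboolP[_ [s sdy saff]] := valP f.
  exists s => // a b a0 b1 ab abs.
  have a01 : 0 <= a <= 1 by lra.
  have b01 : 0 <= b <= 1 by lra.
  have [k kP] := saff (I01_sub a01) (I01_sub b01) ab abs.
  exists k => x xab; have x01 : 0 <= x <= 1 by lra.
  by rewrite (act_in f x01) (act_in f a01); exact: kP.
have [m mP] := common_den sdy; exists m.
apply: uniform_bound => [i M N MN [k [z [kM zE kP]]]|i im].
  have [z' z'E] := dyadic_den MN (ex_intro _ z zE).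
  by exists k, z'; split=> //; exact: leq_trans MN.
have p2 : (0 : R) < 2 ^+ m by rewrite exprn_gt0.
have [||||k kP] := saff (i%:R / 2 ^+ m) (i.+1%:R / 2 ^+ m).
- by rewrite divr_ge0 // ltW.
- by rewrite ler_pdivrMr // mul1r -natrX ler_nat.
- by rewrite ltr_pM2r ?invr_gt0 // ltr_nat.
- move=> c /mP[z ->]; rewrite !ltr_pM2r ?invr_gt0 //.
  by rewrite -[i%:R]/(i%:Z%:~R) -[i.+1%:R]/(i.+1%:Z%:~R) !ltr_int; lia.
have [z [n zE]] : dyadic (act f (i%:R / 2 ^+ m)).
  by apply: act_dyadic; exists i%:Z, m.
have [z' z'E] := dyadic_den (leq_addl `|k|%N n) (ex_intro _ z zE).
by exists (`|k| + n)%N, k, z'; split=> //; exact: leq_addr.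
Qed.

Lemma aligned_on_grid : exists K L : nat, forall j, (j < 2 ^ K)%N ->
  exists d p : nat, [/\ (2 ^ d %| p)%N, act f (j%:R / 2 ^+ K) = p%:R / 2 ^+ L &
    forall x, j%:R / 2 ^+ K <= x <= j.+1%:R / 2 ^+ K ->
      act f x = p%:R / 2 ^+ L +
        2 ^+ d / 2 ^+ L / (2 ^+ 0 / 2 ^+ K) * (x - j%:R / 2 ^+ K)].
Proof.
have [m [N grid]] := affine_on_grid.
(* A fine cell of width 2^-K has image of length 2^(k - K) = 2^d / 2^L with d = N + k. As |k| <= N,
   d is nonnegative and at most 2 N <= K. *)
pose K := (m + 2 * N)%N; pose L := (K + N)%N.
exists K, L => j jK; pose i := (j %/ 2 ^ (2 * N))%N; pose r := (j %% 2 ^ (2 * N))%N.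
have jE : j = (i * 2 ^ (2 * N) + r)%N by exact: divn_eq.
have rlt : (r < 2 ^ (2 * N))%N by rewrite ltn_mod expn_gt0.
have im : (i < 2 ^ m)%N by rewrite ltn_divLR ?expn_gt0 // -expnD.
have [k [z [kN fi faff]]] := grid i im.
pose d := `|(N%:Z + k)%R|%N.
have dE : d%:Z = N%:Z + k by rewrite /d; lia.
have dK : (d <= K)%N by rewrite /K; lia.
have p2 n : (0 : R) < 2 ^+ n by rewrite exprn_gt0.
have n2 n : (2 : R) ^+ n != 0 by rewrite gt_eqF.
have slope : (2 : R) ^ k = 2 ^+ d / 2 ^+ N.
  apply: (mulIf (n2 N)); rewrite divfK // -[2 ^+ N]/(2 ^ N%:Z) -expfzDr ?pnatr_eq0 //.
  by rewrite addrC -dE.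
have iE : i%:R / 2 ^+ m = (i * 2 ^ (2 * N))%N%:R / 2 ^+ K :> R.
  by rewrite natrM natrX /K exprD; field; rewrite !n2.
have jin (x : R) : j%:R / 2 ^+ K <= x <= j.+1%:R / 2 ^+ K ->
    i%:R / 2 ^+ m <= x <= i.+1%:R / 2 ^+ m.
  move=> /andP[jx xj]; apply/andP; split.
    apply: le_trans jx; rewrite iE ler_pM2r ?invr_gt0 // ler_nat jE; lia.
  apply: (le_trans xj).
  have -> : i.+1%:R / 2 ^+ m = (i.+1 * 2 ^ (2 * N))%N%:R / 2 ^+ K :> R.
    by rewrite natrM natrX /K exprD; field; rewrite !n2.
  by rewrite ler_pM2r ?invr_gt0 // ler_nat mulSn; lia.
(* Over the denominator 2^L the left endpoint has image z 2^K + 2^d r, and d <= K lets 2^d be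
   factored out; this gives the alignment. *)
pose q : int := z * 2 ^+ (K - d) + r%:Z.
have fj : act f (j%:R / 2 ^+ K) = (2 ^+ d * q)%:~R / 2 ^+ L.
  rewrite faff; last first.
    by apply: jin; rewrite lexx /= ler_pM2r ?invr_gt0 // ler_nat.
  rewrite fi slope iE -mulrBl {1}jE natrD addrAC subrr add0r.
  rewrite /q /L !rmorphM rmorphD rmorphM !rmorphXn /= exprD -[in 2 ^+ K](subnK dK) exprD.
  rewrite -[r%:~R]/(r%:R).
  by field; rewrite !n2.
have q0 : 0 <= q.
  have : 0 <= act f (j%:R / 2 ^+ K).
    by rewrite -act_0 act_le divr_ge0 // ltW.
  rewrite fj pmulr_lge0 ?invr_gt0 // rmorphM /= rmorphXn /= pmulr_rge0 //.
  by rewrite ler0z.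
exists d, (2 ^ d * `|q|)%N; rewrite dvdn_mulr //.
have pE : (2 ^+ d * q)%:~R = (2 ^ d * `|q|)%N%:R :> R.
  by rewrite natrM natrX rmorphM rmorphXn /= natr_absz ger0_norm.
split=> //; first by rewrite fj pE.
move=> x xj; rewrite -pE -fj faff ?jin //.
rewrite [act f (j%:R / _)]faff; last first.
  by apply: jin; rewrite lexx /= ler_pM2r ?invr_gt0 // ler_nat.
by rewrite slope /L exprD expr0; field; rewrite !n2.
Qed.

Lemma aligned_decomposition : exists K L ds,
  [/\ aligned 0 ds, total_width ds = (2 ^ L)%N &
  aff (act f) 0 0 [seq 2 ^+ d / 2 ^+ K | d <- nseq (2 ^ K) 0%N]
                  [seq 2 ^+ d / 2 ^+ L | d <- ds]].
Proof.
have [K [L grid]] := aligned_on_grid; exists K, L.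
have p2 n : (0 : R) < 2 ^+ n by rewrite exprn_gt0.
have n2 n : (2 : R) ^+ n != 0 by rewrite gt_eqF.
have pinj (p q : nat) : p%:R / 2 ^+ L = q%:R / 2 ^+ L :> R -> p = q.
  by move/(mulIf (invr_neq0 (n2 L)))/eqP; rewrite eqr_nat => /eqP.
(* Built from the right end, where f 1 = 1 fixes the position 2^L; [n] counts the remaining cells.
   The image of each cell ends where the next image starts, by evaluating at the shared endpoint. *)
have main n : forall j, (j + n = 2 ^ K)%N -> exists p ds,
    [/\ aligned p ds, (p + total_width ds = 2 ^ L)%N,
      act f (j%:R / 2 ^+ K) = p%:R / 2 ^+ L &
    aff (act f) (j%:R / 2 ^+ K) (p%:R / 2 ^+ L)
      [seq 2 ^+ d / 2 ^+ K | d <- nseq n 0%N] [seq 2 ^+ d / 2 ^+ L | d <- ds]].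
  elim: n => [|n IH] j.
    rewrite addn0 => ->; exists (2 ^ L)%N, [::].
    by rewrite total_width_nil addn0 !natrX !divff // act_1.
  rewrite addnS -addSn => jn.
  have [q [ds [ads tds fq qaff]]] := IH _ jn.
  have [|d [p [dp fp paff]]] := grid j; first by lia.
  have step : j%:R / 2 ^+ K + 1 / 2 ^+ K = j.+1%:R / 2 ^+ K :> R.
    by rewrite -mulrDl natr1.
  have step' : p%:R / 2 ^+ L + 2 ^+ d / 2 ^+ L = (p + 2 ^ d)%N%:R / 2 ^+ L :> R.
    by rewrite natrD natrX mulrDl.
  have qE : q = (p + 2 ^ d)%N.
    apply: pinj; rewrite -fq paff; last first.
      by rewrite lexx andbT -step lerDl divr_ge0 // ltW.
    by rewrite -step -step' addrAC subrr add0r expr0; field; rewrite !n2.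
  exists p, (d :: ds); rewrite total_width_cons /= dp -qE ads.
  split=> //; first by lia.
  split; rewrite ?divr_gt0 //.
    by rewrite expr0 step.
  by rewrite expr0 step step' -qE.
have [p [ds [ads tds fp paff]]] := main (2 ^ K)%N 0%N (add0n _).
have p0 : p = 0%N by apply: pinj; rewrite -fp !mul0r act_0.
exists ds; move: paff ads tds; rewrite p0 !mul0r add0n.
by move=> ? ? ?; split.
Qed.

End FiniteGeneration.

Lemma dyadic1 (R : realType) : dyadic (1 : R).
Proof. by exists 1, 0%N; rewrite expr0 divr1. Qed.

Lemma dyadic_half (R : realType) : dyadic (1 / 2 : R).
Proof. by exists 1, 1%N. Qed.

Lemma thompson_finitely_generated (R : realType) :
  finitely_generated [set: thompson R].
Proof.
have [x0 x0P] :=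
  bump_exists (ltr01 : (0 : R) < 1) (lexx 0) (lexx 1) (dyadic0 R) (dyadic1 R).
have [x1 x1P] : exists g : thompson R, forall x, act g x = bump_fun (1 / 2) 1 x.
  by apply: bump_exists; [lra|lra|lra|exact: dyadic_half|exact: dyadic1].
exists [:: x0; x1]; apply/seteqP; split=> // f _.
have [K [L [ds [ads tds faff]]]] := aligned_decomposition f.
have zds n p : aligned p (nseq n 0%N) /\ total_width (nseq n 0%N) = n.
  elim: n p => [|n IH] p; first by rewrite total_width_nil.
  by have [a t] := IH (p + 1)%N; rewrite total_width_cons t /= dvd1n.
have [z t] := zds (2 ^ K)%N 0%N.
have [g1 G1 g1P] := aligned_vine x0P x1P z t.
have [g2 G2 g2P] := aligned_vine x0P x1P ads tds.
(* [f] carries the uniform grid to [ds], and [g1], [g2] carry these two to the same vine because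
   they have equally many pieces. So g2 f and g1 agree on [0, 1), and also at 1. *)
have -> : f = (g2^-1 * g1)%g.
  have g2f := aff_comp faff g2P.
  have sz : size (nseq (2 ^ K) 0%N) = size ds.
    by have := aff_size faff; rewrite !size_map.
  rewrite sz in g1P.
  apply: act_ext => x /andP[x0' x1']; apply: (can_inj (actK g2)).
  rewrite actM actVK.
  move: x1'; rewrite le_eqVlt => /orP[/eqP->|x1']; first by rewrite !act_1.
  apply: (aff_eq g2f g1P); rewrite x0' add0r.
  have -> : \sum_(w <- [seq 2 ^+ d / 2 ^+ K | d <- nseq (2 ^ K) 0%N]) w = 1 :> R.
    rewrite big_map big_nseq expr0 -[iter _ _ _]/(iter (2 ^ K) (+%R (1 / 2 ^+ K)) 0).
    by rewrite iter_addr addr0 -(mulr_natr (1 / 2 ^+ K)) natrX mulfVK ?expf_neq0 ?pnatr_eq0.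
  by [].
by apply: generatedM => //; apply: generatedV.
Qed.

(** * The embedding *)

Section Moving.
Variable R : realType.
Implicit Types (g h : thompson R) (p x : R).

Lemma act_fixV g x : act g x = x -> act g^-1%g x = x.
Proof. by move=> gx; rewrite -{1}gx actK. Qed.

Lemma act_fixX g x n : act g x = x -> act (zpow g n) x = x.
Proof.
move=> gx; have pos k : act (g ^+ k)%g x = x.
  by elim: k => [|k IH]; rewrite ?act1 // expgS actM IH.
by case: n => k //=; apply: act_fixV.
Qed.

(** An increasing map keeps moving a point in the direction of the first step, so it never
    returns. *)
Lemma act_moveX g x n : act g x <> x -> n <> 0 -> act (zpow g n) x <> x.
Proof.
move=> gx; have pos k : act (g ^+ k.+1)%g x <> x.
  have [lt|gt|//] := ltgtP (act g x) x.
    suff : act (g ^+ k.+1)%g x < x by move=> /[swap] ->; rewrite ltxx.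
    elim: k => [|k IH]; first by rewrite expg1.
    by rewrite expgS actM; apply: lt_trans lt; rewrite act_ltE.
  suff : x < act (g ^+ k.+1)%g x by move=> /[swap] ->; rewrite ltxx.
  elim: k => [|k IH]; first by rewrite expg1.
  by rewrite expgS actM; apply: (lt_trans gt); rewrite act_ltE.
case: n => [[|k]|k] /= n0; [by case: n0|exact: pos|].
by move/act_fixV; rewrite invgK; exact: pos.
Qed.

Lemma commute_separated g h p : (forall x, p <= x -> act g x = x) ->
  (forall x, x <= p -> act h x = x) -> commute g h.
Proof.
move=> gP hP; apply: act_ext => x _; rewrite !actM.
have [xp|/ltW px] := leP x p.
  by rewrite (hP x xp) hP // -[leRHS]gP // act_le.
by rewrite (gP x px) gP // -[leLHS]hP // act_le.
Qed.

End Moving.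

(** * Supports of the lamps and injectivity *)

Section Embedding.
Variable R : realType.
Variables a b : thompson R.
Hypothesis aP : forall x, act a x = bump_fun (1 / 2) (3 / 4) x.
Hypothesis bP : forall x, act b x = bump_fun 0 1 x.

(** The orbit of 1/2 under [b]; the lamp A_i is supported in [orb i, orb (i + 1)]. *)
Let orb (i : int) : R := act (zpow b i) (1 / 2).

Lemma act_b_half : act b (1 / 2) = 3 / 4.
Proof. by rewrite bP bump_fun2; lra. Qed.

Lemma orb1 i : orb (i + 1) = act (zpow b i) (3 / 4).
Proof. by rewrite /orb zpowSr actM act_b_half. Qed.

Lemma orb_lt : {homo orb : i j / i < j}.
Proof.
move=> i j ij; rewrite (_ : j = i + `|(j - i)%R|%N); last by lia.
have : (0 < `|(j - i)%R|)%N by lia.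
have step k : orb k < orb (k + 1) by rewrite orb1 act_ltE; lra.
case: `|_|%N => // n _; elim: n => [|n IH]; first exact: step.
by apply: (lt_trans IH); rewrite -(addn1 n.+1) PoszD addrA; exact: step.
Qed.

Lemma orb_le : {homo orb : i j / i <= j}.
Proof. exact/ltW_homo/orb_lt. Qed.

Lemma act_lamp_at i x :
  act (lamp_at a b i) x = act (zpow b i) (act a (act (zpow b (- i)) x)).
Proof. by rewrite /lamp_at conjgE !actM zpowN invgK. Qed.

Lemma orbK i x : act (zpow b i) (act (zpow b (- i)) x) = x.
Proof. by rewrite zpowN actVK. Qed.

Lemma lamp_fix_left i x : x <= orb i -> act (lamp_at a b i) x = x.
Proof.
move=> xi; rewrite act_lamp_at aP bump_fun_left ?orbK //; first by lra.
by rewrite -(act_le (zpow b i)) orbK.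
Qed.

Lemma lamp_fix_right i x : orb (i + 1) <= x -> act (lamp_at a b i) x = x.
Proof.
move=> xi; rewrite act_lamp_at aP bump_fun_right ?orbK //; first by lra.
by rewrite -(act_le (zpow b i)) orbK -orb1.
Qed.

Lemma lamp_separated n : commute a (lamp_at a b n).
Proof.
have a0 : a = lamp_at a b 0 by rewrite /lamp_at oppr0 conjg1.
have [n0|n0|->] := ltgtP n 0; last by rewrite -a0.
  apply: commute_sym; apply: (@commute_separated _ _ _ (orb 0)) => x x0.
    by apply: lamp_fix_right; apply: le_trans x0; apply: orb_le; lia.
  by rewrite a0 lamp_fix_left.
apply: (@commute_separated _ _ _ (orb 1)) => x x1.
  by rewrite a0 lamp_fix_right.
by apply: lamp_fix_left; apply: (le_trans x1); apply: orb_le; lia.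
Qed.

Lemma lamp_diff_fix_right i x : orb (i + 2) <= x ->
  act (lamp_at (lamp_diff a b) b i) x = x.
Proof.
move=> ix; rewrite lamp_at_diff actM act_fixV; last first.
  by apply: lamp_fix_right; rewrite -addrA.
by apply: lamp_fix_right; apply: le_trans ix; apply: orb_le; lia.
Qed.

Lemma lamp_fix_orb i j : act (lamp_at a b i) (orb j) = orb j.
Proof.
have [ji|ij] := leP j i; first exact/lamp_fix_left/orb_le.
by apply/lamp_fix_right/orb_le; lia.
Qed.

(** All lamps fix the ends of their supports, so the image of 1/2 under an element of the image
    reveals its cursor. *)
Lemma lamps_fix_orb s f j : act (lamps (lamp_diff a b) b s f) (orb j) = orb j.
Proof.
rewrite /lamps; elim: s => [|i s IH]; first by rewrite big_nil act1.
rewrite big_cons actM IH; apply: act_fixX.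
by rewrite lamp_at_diff actM act_fixV ?lamp_fix_orb.
Qed.

(** The point is interior to the support of A_(i+1), hence fixed by A_i, whereas A_(i+1) moves it
    because [a] sends 5/8 to 11/16. *)
Lemma lamp_diff_move i : act (lamp_at (lamp_diff a b) b i) (act (zpow b (i + 1)) (5 / 8))
  <> act (zpow b (i + 1)) (5 / 8).
Proof.
set p := act _ (5 / 8); rewrite lamp_at_diff actM => E.
have fi : act (lamp_at a b i) p = p.
  by apply: lamp_fix_right; rewrite act_le; lra.
have : act (lamp_at a b (i + 1))^-1%g p = p.
  by rewrite -[LHS](actK (lamp_at a b i)) E act_fixV.
move/act_fixV; rewrite invgK act_lamp_at /p zpowN actK => /(can_inj (actK _)).
by rewrite aP bump_fun3; lra.
Qed.

Lemma wreath_hom_inj : injective (wreath_hom (lamp_diff a b) b).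
Proof.
have c := lamp_diff_comm lamp_separated.
suff ker u : wreath_hom (lamp_diff a b) b u = 1%g -> u = 1%g.
  move=> u v uv; have : (u * v^-1)%g = 1%g.
    by apply: ker; rewrite wreath_homM // wreath_homV // uv mulgV.
  by move/divg1_eq.
move=> u1; have su : cursor u = 0.
  have : orb (cursor u) = orb 0.
    by rewrite -(lamps_fix_orb (lamp_supp u) (lamp u)) /orb -actM -/(wreath_hom _ _ u) u1.
  have [lt|lt|//] := ltgtP (cursor u) 0; have := orb_lt lt.
    by move=> /[swap] ->; rewrite ltxx.
  by move=> /[swap] ->; rewrite ltxx.
have lu : lamps (lamp_diff a b) b (lamp_supp u) (lamp u) = 1%g.
  by move: u1; rewrite /wreath_hom su mulg1.
apply: ZwrZ_ext => // i; rewrite [RHS]/(0 : int).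
apply: contrapT => ui.
(* The topmost lit lamp, found through a cast to R so that [seq_max] applies. *)
have [j uj jmax] : exists2 j, lamp u j <> 0 & forall k, j < k -> lamp u k = 0.
  pose t : seq R := [seq k%:~R | k <- lamp_supp u & lamp u k != 0].
  have it : i%:~R \in t.
    by apply/map_f; rewrite mem_filter lamp_suppP // andbT; apply/eqP.
  have [_ /mapP[j + ->] jmax] := seq_max it.
  rewrite mem_filter => /andP[/eqP uj js]; exists j => // k jk.
  apply: contrapT => uk; have : k%:~R \in t.
    by apply/map_f; rewrite mem_filter lamp_suppP // andbT; apply/eqP.
  by move/jmax; rewrite ler_int leNgt jk.
(* This point lies beyond the support of every C_k with k < j, and the factors with k > j are
   trivial. Only the factor at [j] can move it, and it does, so the product is not 1. *)
pose p := act (zpow b (j + 1)) (5 / 8).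
pose F k := zpow (lamp_at (lamp_diff a b) b k) (lamp u k).
have Ffix k : k != j -> act (F k) p = p.
  move=> kj; rewrite /F; have [jk|kj'] := ltP j k; first by rewrite jmax // act1.
  apply/act_fixX/lamp_diff_fix_right/(@le_trans _ _ (orb (j + 1))).
    by apply: orb_le; lia.
  by rewrite act_le; lra.
have prodfix (s : seq int) : j \notin s -> act (\prod_(k <- s) F k)%g p = p.
  elim: s => [|k s IH]; first by rewrite big_nil act1.
  rewrite inE negb_or eq_sym => /andP[kj js].
  by rewrite big_cons actM IH // Ffix.
have := lamp_supp_uniq u; move: (lamp_suppP uj) lu; rewrite /lamps.
case/splitPr => s1 s2; rewrite big_cat big_cons /=.
rewrite -[(_ * _)%g]/((\prod_(k <- s1) F k) * (F j * \prod_(k <- s2) F k))%g => E.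
rewrite cat_uniq /= negb_or => /and3P[_ /andP[j1 _] /andP[j2 _]].
have : act (F j) p = p.
  apply: (can_inj (actK (\prod_(k <- s1) F k)%g)).
  have := congr1 (fun g => act g p) E; rewrite act1 !actM (prodfix s2) // => Ep.
  by rewrite (prodfix s1).
by apply: act_moveX => //; exact: lamp_diff_move.
Qed.

End Embedding.

Theorem corollary1p6 (R : realType) :
  exists phi : {multiplicative
      wreath (Algebra.to_multiplicative int) (Algebra.to_multiplicative int) -> thompson R},
    injective phi /\ distorted (range phi).
Proof.
have half := dyadic_half R.
have [b bP] :=
  bump_exists (ltr01 : (0 : R) < 1) (lexx 0) (lexx 1) (dyadic0 R) (dyadic1 R).
have [a aP] : exists g : thompson R, forall x, act g x = bump_fun (1 / 2) (3 / 4) x.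
  apply: bump_exists => //; try lra.
  by exists 3, 2%N; congr (_ / _); rewrite -natrX.
have inj := wreath_hom_inj aP bP.
have comm := lamp_separated aP bP.
pose phiM := isMultiplicative.Build _ _ _ (wreath_homM (lamp_diff_comm comm)).
pose phi : {multiplicative ZwrZ -> thompson R} :=
  HB.pack (wreath_hom (lamp_diff a b) b) phiM.
exists phi; split => //.
exact: (wreath_hom_distorted comm inj (thompson_finitely_generated R)).
Qed.
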